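(* Assume that $\rho$ satisfies: $\rho\in H^2(0,\pi)$, $0<\rho(x)\le\beta_0$ for all $x\in[0,\pi]$ (for some constant $\beta_0$), and $\rho_0=\operatorname{ess\,inf}\eta_\rho>0$. Let $0<p<1$, let the boundary conditions be of Neumann type, i.e. $\alpha_1=0,\ \beta_1>0,\ \alpha_2=0,\ \beta_2>0$, and let $\mu$ be a real constant with $\mu\notin\Lambda(L)$ and $\mu>\rho_1$, where $\rho_1=\frac{2}{\pi}\int_0^\pi\eta_\rho(x)\,dx$. Then the problem $$\rho(x)u_{tt}-(\rho(x)u_x)_x=\mu\rho(x)u+\rho(x)|u|^{p-1}u,\quad (t,x)\in\Omega,$$ $$a_1u(t,0)+b_1u_x(t,0)=0,\quad a_2u(t,\pi)+b_2u_x(t,\pi)=0,\quad t\in(0,T),$$ $$u(0,x)=u(T,x),\quad u_t(0,x)=u_t(T,x),\quad x\in(0,\pi),$$ has infinitely many periodic weak solutions $u_l$ satisfying $$\int_\Omega|u_l|^{p+1}\rho\,dt\,dx\to0\quad\text{as } l\to\infty.$$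
   Context: $T=2\pi a/b$ with $a,b$ relatively prime positive integers; $\Omega=(0,T)\times(0,\pi)$; $a_i,b_i\in\mathbb R$ with $a_i^2+b_i^2\ne0$ for $i=1,2$. Unknown functions $u$ are real-valued. $\eta_\rho=\frac12\frac{\rho''}{\rho}-\frac14\left(\frac{\rho'}{\rho}\right)^2$. Also $\alpha_1=a_1-\frac{b_1}{2}\frac{\rho'(0)}{\rho(0)}$, $\alpha_2=a_2-\frac{b_2}{2}\frac{\rho'(\pi)}{\rho(\pi)}$, $\beta_1=-b_1$, $\beta_2=b_2$. For $r\ge1$, $L^r(\Omega)$ is the space of $u$ with $\|u\|_{L^r(\Omega)}^r=\int_\Omega|u|^r\rho\,dt\,dx<\infty$. $\Psi$ is the set of functions $\psi$ that are $C^\infty$ on $\Omega$ up to the boundary and satisfy $a_1\psi(t,0)+b_1\psi_x(t,0)=0$, $a_2\psi(t,\pi)+b_2\psi_x(t,\pi)=0$, $\psi(0,x)=\psi(T,x)$, $\psi_t(0,x)=\psi_t(T,x)$. A function $u\in L^r(\Omega)$ is a weak solution of the problem if $\int_\Omega u(\rho\psi_{tt}-(\rho\psi_x)_x)\,dt\,dx-\int_\Omega(\mu u+|u|^{p-1}u)\psi\rho\,dt\,dx=0$ for all $\psi\in\Psi$. Let $\lambda_k^2$ be the eigenvalues (listed increasingly) of the Sturm–Liouville problem $-(\rho\varphi')'=\lambda^2\rho\varphi$ on $(0,\pi)$, $a_1\varphi(0)+b_1\varphi'(0)=0$, $a_2\varphi(\pi)+b_2\varphi'(\pi)=0$, and let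 $\nu_j=2\pi j/T$, $j\in\mathbb Z$. Then $\Lambda(L)$ denotes the set of all numbers $\lambda_{jk}=\lambda_k^2-\nu_j^2$; these are the eigenvalues of the wave operator $L$ (the self-adjoint extension to $L^2(\Omega)$ of $\psi\mapsto\rho^{-1}(\rho\psi_{tt}-(\rho\psi_x)_x)$, $\psi\in\Psi$). *)

(* Defs.v *)
From mathcomp Require Import all_boot all_order all_algebra.
From mathcomp Require Import all_classical all_reals all_analysis ess_sup_inf.

Set Implicit Arguments.
Unset Strict Implicit.
Unset Printing Implicit Defensive.

Import Order.TTheory GRing.Theory Num.Theory.
Import numFieldNormedType.Exports.

Local Open Scope classical_set_scope.
Local Open Scope ring_scope.

Definition Iopen (R : realType) : set R := `]0, pi[%classic.

Definition Iclosed (R : realType) : set R := `[0, pi]%classic.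

Arguments Iopen R : clear implicits.
Arguments Iclosed R : clear implicits.

Definition in_L2 (R : realType) (f : R -> R) : Prop :=
  measurable_fun (Iopen R) f /\
  (\int[lebesgue_measure]_(x in (Iopen R)) ((f x ^+ 2)%:E) < +oo)%E.

(* C_c^oo(0, pi) *)
Definition test_function (R : realType) (phi : R -> R) : Prop :=
  (forall n x, derivable (derive1n n phi) x 1) /\
  exists c d : R, [/\ 0 < c, d < pi & forall x, phi x != 0 -> c <= x <= d].

Definition weak_derivative (R : realType) (f g : R -> R) : Prop :=
  forall phi : R -> R, test_function phi ->
    \int[lebesgue_measure]_(x in (Iopen R)) (f x * derive1 phi x) =
    - \int[lebesgue_measure]_(x in (Iopen R)) (g x * phi x).

(* rho is in H^2(0, pi) with weak derivatives rho' = rho1 and rho'' = rho2.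
   rho and rho1 are the representatives that are continuous on [0, pi], so
   that their pointwise values, including at 0 and pi, are meaningful; rho2 is
   only determined almost everywhere. *)
Definition in_H2 (R : realType) (rho rho1 rho2 : R -> R) : Prop :=
  [/\ [/\ in_L2 rho, in_L2 rho1 & in_L2 rho2],
      {within (Iclosed R), continuous rho},
      {within (Iclosed R), continuous rho1},
      weak_derivative rho rho1
    & weak_derivative rho1 rho2].

Definition eta_rho (R : realType) (rho rho1 rho2 : R -> R) (x : R) : R :=
  2^-1 * (rho2 x / rho x) - 4^-1 * (rho1 x / rho x) ^+ 2.

Definition ess_inf_0pi (R : realType) (f : R -> R) : \bar R :=
  ess_inf (mrestr (@lebesgue_measure R) (measurable_itv `]0, (@pi R)[)) (EFin \o f).

Definition period (R : realType) (a b : nat) : R := 2 * pi * a%:R / b%:R.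

Definition Omega (R : realType) (T : R) : set (R * R) :=
  `]0, T[%classic `*` (Iopen R).

Definition Omega_bar (R : realType) (T : R) : set (R * R) :=
  `[0, T]%classic `*` (Iclosed R).

Definition leb2 (R : realType) :=
  ((@lebesgue_measure R) \x (@lebesgue_measure R))%E.

Arguments leb2 R : clear implicits.

(* The integral of |u|^r rho over Omega, i.e. the r-th power of the L^r norm. *)
Definition powint (R : realType) (rho : R -> R) (T r : R) (u : R * R -> R) : \bar R :=
  (\int[leb2 R]_(z in Omega T) ((`|u z| `^ r * rho z.2)%:E))%E.

Definition in_Lr (R : realType) (rho : R -> R) (T r : R) (u : R * R -> R) : Prop :=
  measurable_fun (Omega T) u /\ (powint rho T r u < +oo)%E.

(* psi is C^oo on Omega up to the boundary: d i j is the partial derivative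
   of psi of order i in t and j in x, extended continuously to the closed
   rectangle. *)
Definition smooth_upto_boundary (R : realType) (T : R) (psi : R * R -> R)
    (d : nat -> nat -> R * R -> R) : Prop :=
  [/\ forall z, Omega_bar T z -> psi z = d 0%N 0%N z,
      forall i j, {within Omega_bar T, continuous (d i j)},
      forall i j t x, Omega T (t, x) ->
        is_derive t (1 : R) (fun s => d i j (s, x)) (d i.+1 j (t, x))
    & forall i j t x, Omega T (t, x) ->
        is_derive x (1 : R) (fun y => d i j (t, y)) (d i j.+1 (t, x))].

Definition Psi (R : realType) (a1 b1 a2 b2 T : R) : set (R * R -> R) :=
  [set psi | exists d, [/\ smooth_upto_boundary T psi d,
    forall t, 0 <= t <= T -> a1 * psi (t, 0) + b1 * d 0%N 1%N (t, 0) = 0,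
    forall t, 0 <= t <= T -> a2 * psi (t, pi) + b2 * d 0%N 1%N (t, pi) = 0,
    forall x, 0 <= x <= pi -> psi (0, x) = psi (T, x)
  & forall x, 0 <= x <= pi -> d 1%N 0%N (0, x) = d 1%N 0%N (T, x)]].

(* rho psi_tt - (rho psi_x)_x; it is only evaluated inside Omega. *)
Definition wave_op (R : realType) (rho : R -> R) (psi : R * R -> R) (z : R * R) : R :=
  rho z.2 * derive1n 2 (fun s => psi (s, z.2)) z.1 -
  derive1 (fun y => rho y * derive1 (fun y' => psi (z.1, y')) y) z.2.

Definition weak_solution (R : realType) (rho : R -> R) (a1 b1 a2 b2 T mu p r : R)
    (u : R * R -> R) : Prop :=
  in_Lr rho T r u /\
  forall psi, Psi a1 b1 a2 b2 T psi ->
    \int[leb2 R]_(z in Omega T) (u z * wave_op rho psi z) -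
    \int[leb2 R]_(z in Omega T)
      ((mu * u z + `|u z| `^ (p - 1) * u z) * psi z * rho z.2) = 0.

(* lam plays the role of lambda^2. Since rho is C^1 on [0, pi], an
   eigenfunction phi is C^1 on [0, pi], with derivative phi1, and rho phi'
   is differentiable in the classical sense. *)
Definition SL_eigenvalue (R : realType) (rho : R -> R) (a1 b1 a2 b2 lam : R) : Prop :=
  exists phi phi1 : R -> R,
  [/\ {within (Iclosed R), continuous phi} /\
        {within (Iclosed R), continuous phi1},
      forall x, 0 < x < pi -> is_derive x (1 : R) phi (phi1 x),
      forall x, 0 < x < pi ->
        is_derive x (1 : R) (fun y => rho y * phi1 y) (- (lam * rho x * phi x)),
      a1 * phi 0 + b1 * phi1 0 = 0 /\ a2 * phi pi + b2 * phi1 pi = 0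
    & exists2 x, 0 <= x <= pi & phi x != 0].

(* Lambda(L) = {lambda_k^2 - nu_j^2} with nu_j = 2 pi j / T. *)
Definition Lambda (R : realType) (rho : R -> R) (a1 b1 a2 b2 T : R) : set R :=
  [set l | exists (lam : R) (j : int),
     SL_eigenvalue rho a1 b1 a2 b2 lam /\ l = lam - (2 * pi * j%:~R / T) ^+ 2].

(* Main.v *)
Require Import Defs.
From mathcomp Require Import all_boot all_order all_algebra.
From mathcomp Require Import all_classical all_reals all_analysis ess_sup_inf.
From mathcomp Require Import measurable_realfun ring lra.
Import Order.TTheory GRing.Theory Num.Theory.
Import numFieldNormedType.Exports.
Local Open Scope classical_set_scope.
Local Open Scope ring_scope.
Set Implicit Arguments.
Unset Strict Implicit.
Unset Printing Implicit Defensive.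

(** Since the nonlinearity is sublinear, small solutions can be found among the
    functions u of x alone. For these the problem becomes the Sturm-Liouville
    problem
      - (rho u')' = rho (mu u + |u|^(p-1) u)
    with the boundary conditions of the problem, and any solution of it is a
    weak solution of the wave problem for every period: u rho psi_tt integrates
    to 0 because psi is periodic, and two integrations by parts turn
    - u (rho psi_x)_x into the right-hand side times psi (stationary_identity).

    The Sturm-Liouville problem has solutions of arbitrarily small amplitude
    s > 0 because the restoring force |u|^(p-1) is of order s^(p-1) = k^2, which
    tends to infinity as s tends to 0. Writing u = s U and rho u' = s k V, the
    point (U, V) starts close to (1, 0), in the direction given by the condition
    at x = 0; an energy whose logarithmic derivative is bounded independently of
    k keeps it in a fixed annulus (solution_bounds); and its polar angle turns at
    a speed of order k (angle_slope). As k grows, the final angle sweeps over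
    infinitely many turns, hence meets the direction of the condition at x = pi
    for some arbitrarily large k (small_solutions).

    The field is not Lipschitz at U = 0, where the classical theorems on
    uniqueness and continuous dependence on k do not apply. The intermediate
    value argument is therefore made on Euler schemes, which are
    continuous in k, and the exact solution is a limit of schemes along an
    ultrafilter (euler_shooting).

    The coefficient rho is given as a continuous function with a continuous weak
    derivative; it is first shown to be differentiable in the classical sense
    (weak_derivative_is_derive), by testing against differences of smooth steps.

    A sequence of solutions whose amplitudes decrease fast enough, each being
    at most half of the value at x = 0 of every previous solution, consists of
    pairwise distinct functions whose norms tend to 0. *)

(** * Euler schemes *)

Lemma cvg_to_pair (I : Type) (U V : topologicalType) (F : set_system I)
    (FF : Filter F) (f : I -> U) (g : I -> V) (a : U) (b : V) :
  f @ F --> a -> g @ F --> b -> (fun i => (f i, g i)) @ F --> (a, b).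
Proof. by move=> fa gb; exact: (cvg_pair fa gb). Qed.

Lemma cvg_comp_pair (I : Type) (U V W : topologicalType) (F : set_system I)
    (FF : Filter F) (h : U * V -> W) (f : I -> U) (g : I -> V) (a : U) (b : V) :
  {for (a, b), continuous h} -> f @ F --> a -> g @ F --> b ->
  (fun i => h (f i, g i)) @ F --> h (a, b).
Proof.
by move=> hc fa gb; apply: (@continuous_cvg _ _ _ F _ (fun i => (f i, g i)) h (a, b) hc);
  exact: cvg_to_pair.
Qed.

Section euler_scheme.
Variables (R : realType) (V : normedModType R).
Variables (F : R * R * V -> V) (y0 : R -> V).

Fixpoint euler (h t : R) (k : nat) : V :=
  if k is k'.+1 then
    euler h t k' + h *: F (t, k'%:R * h, euler h t k')
  else y0 t.

Lemma euler_continuous : continuous F -> continuous y0 ->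
  forall h k, continuous (fun t => euler h t k).
Proof.
move=> cF cy0 h; elim=> [|k IH] t /=; first exact: cy0.
apply: (@cvgD R V R (nbhs t) _ (fun t => euler h t k) (fun t => h *: F (t, k%:R * h, euler h t k)) (euler h t k) _ (IH t)).
apply: cvgZ; first exact: cvg_cst.
apply: (@continuous_cvg _ _ _ _ _ _ F _ (cF (t, k%:R * h, euler h t k))).
apply: cvg_to_pair; last exact: IH.
by apply: cvg_to_pair; [exact: cvg_id|exact: cvg_cst].
Qed.

(** Discrete Gronwall: linear growth of the field keeps the scheme bounded
    uniformly in the step. *)
Lemma euler_growth (h t C : R) : 0 <= h -> 0 <= C ->
  (forall x v, `|F (t, x, v)| <= C * (1 + `|v|)) ->
  forall k, 1 + `|euler h t k| <= (1 + `|y0 t|) * expR (C * (k%:R * h)).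
Proof.
move=> h0 C0 HF; elim=> [|k IH] /=.
  by rewrite mul0r mulr0 expR0 mulr1.
have H1 : `|euler h t k + h *: F (t, k%:R * h, euler h t k)| <=
    `|euler h t k| + h * (C * (1 + `|euler h t k|)).
  apply: (le_trans (ler_normD _ _)); rewrite lerD2l normrZ ger0_norm//.
  by rewrite ler_wpM2l.
have H2 : 1 + `|euler h t k.+1| <= (1 + `|euler h t k|) * (1 + C * h).
  by move: H1 => /=; lra.
apply: (le_trans H2).
have -> : C * (k.+1%:R * h) = C * (k%:R * h) + C * h by rewrite -natr1; ring.
rewrite expRD [leRHS]mulrA; apply: ler_pM => //.
- by rewrite addr_ge0// mulr_ge0.
- exact: expR_ge1Dx.
Qed.

(** With w a value of the field this measures how far the scheme is from having
    slope w; with w = 0 it is the Lipschitz bound. *)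
Lemma euler_increment (h t e : R) (w : V) (i n : nat) : 0 <= h ->
  (forall k, (i <= k < i + n)%N ->
     `|F (t, k%:R * h, euler h t k) - w| <= e) ->
  `|euler h t (i + n) - euler h t i - (n%:R * h) *: w| <= n%:R * h * e.
Proof.
move=> h0; elim: n => [|n IH] H.
  by rewrite addn0 subrr !mul0r scale0r subr0 normr0.
have H1 : `|euler h t (i + n) - euler h t i - (n%:R * h) *: w| <= n%:R * h * e.
  by apply: IH => k /andP[ik kn]; apply: H; rewrite ik (ltn_trans kn)// addnS.
have H2 : `|F (t, (i + n)%:R * h, euler h t (i + n)) - w| <= e.
  by apply: H; rewrite leq_addr addnS ltnS leqnn.
rewrite addnS /=.
have -> : euler h t (i + n) + h *: F (t, (i + n)%:R * h, euler h t (i + n)) -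
    euler h t i - (n.+1%:R * h) *: w =
  (euler h t (i + n) - euler h t i - (n%:R * h) *: w) +
    h *: (F (t, (i + n)%:R * h, euler h t (i + n)) - w).
  rewrite -natr1 mulrDl mul1r scalerDl scalerBr.
  by rewrite opprD (addrAC (euler h t (i + n))) addrACA.
apply: (le_trans (ler_normD _ _)).
rewrite -natr1 mulrDl mul1r mulrDl lerD// normrZ ger0_norm//.
by rewrite ler_wpM2l.
Qed.

End euler_scheme.

(** The shape of the conclusion survives a passage to the limit, whereas the
    sign hypotheses of the intermediate value theorem at a and b are only
    available for limits of the functions to which this is applied. *)
Lemma clamped_IVT (R : realType) (f : R -> R) (a b : R) : a <= b ->
  continuous f ->
  exists2 c, a <= c <= b &
    [\/ f c = 0, c = a /\ 0 <= f c | c = b /\ f c <= 0].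
Proof.
move=> ab cf.
have [fa|fa] := leP 0 (f a).
  by exists a; [rewrite lexx|apply: Or32].
have [fb|fb] := leP (f b) 0.
  by exists b; [rewrite lexx andbT|apply: Or33].
have := @IVT R f a b 0 ab (continuous_subspaceT cf).
case.
  by rewrite ge_min le_max (ltW fa) (ltW fb) orbT.
move=> c; rewrite in_itv /= => cab fc.
by exists c => //; apply: Or31.
Qed.

(** * Shooting for continuous vector fields *)

Lemma fmap_ultra (I T : Type) (u : I -> T) (U : set_system I) :
  UltraFilter U -> UltraFilter (u @ U).
Proof.
move=> UU; have PU : ProperFilter U by case: UU.
split; first exact: fmap_proper_filter.
move=> G PG UG; rewrite predeqE => A; split; last exact: UG.
move=> GA; have [//|UnA] := @in_ultra_setVsetC _ U (u @^-1` A) UU.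
exfalso; apply: (@filter_not_empty _ G _).
have GnA : G (~` A) by apply: UG.
by rewrite -(setICr A); exact: filterI GA GnA.
Qed.

Section shooting.
Variables (R : realType) (V : normedModType R).
Hypothesis compact_balls : forall M : R, compact [set v : V | `|v| <= M].
Variables (F : R * R * V -> V) (y0 : R -> V) (g : R * V -> R).
Hypotheses (cF : continuous F) (cy0 : continuous y0) (cg : continuous g).
Variables (t1 t2 C : R).
Hypotheses (t12 : t1 <= t2) (C0 : 0 <= C).
Hypothesis growth : forall t x v, t1 <= t <= t2 ->
  `|F (t, x, v)| <= C * (1 + `|v|).

Let step (N : nat) : R := N.+1%:R^-1.
Let node (N : nat) (x : R) : nat := Num.truncn (x * N.+1%:R).

Let step_gt0 N : 0 < step N.
Proof. by rewrite /step invr_gt0. Qed.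

Let node_itv N (x : R) : 0 <= x ->
  (node N x)%:R * step N <= x < (node N x)%:R * step N + step N.
Proof.
move=> x0; have /truncn_itv/andP[H1 H2] : 0 <= x * N.+1%:R by rewrite mulr_ge0.
rewrite /step -[X in _ < _ + X]mul1r -mulrDl natr1.
by rewrite ler_pdivrMr// ltr_pdivlMr// H1 H2.
Qed.

Let node_le N (x x' : R) : x <= x' -> (node N x <= node N x')%N.
Proof. by move=> xx'; apply: le_truncn; rewrite ler_wpM2r. Qed.

(** Shooting without uniqueness. For a field F that is merely continuous, the
    value at X of a solution is not a function of the parameter t, so that the
    intermediate value theorem does not apply to solutions. It applies to the
    Euler scheme of each step, whose value at X is continuous in t; the
    parameters and schemes so obtained converge along an ultrafilter (pointwise
    boundedness is enough for that), and the limit solves the equation. The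
    derivative is stated as a first-order expansion, which covers the endpoint
    x = 0 and is inherited by the components of y. *)
Lemma euler_shooting (X : R) : 0 <= X ->
  exists (t : R) (y : R -> V), [/\ t1 <= t <= t2, y 0 = y0 t,
    forall x : R, 0 <= x -> forall e : R, 0 < e -> exists2 d : R, 0 < d &
      forall x' : R, 0 <= x' -> `|x' - x| < d ->
        `|y x' - y x - (x' - x) *: F (t, x, y x)| <= e * `|x' - x|
  & [\/ g (t, y X) = 0, t = t1 /\ 0 <= g (t, y X)
      | t = t2 /\ g (t, y X) <= 0] ].
Proof.
move=> X0.
pose yN N t x := euler F y0 (step N) t (node N x).
have : forall N, exists t, t1 <= t <= t2 /\
    [\/ g (t, yN N t X) = 0, t = t1 /\ 0 <= g (t, yN N t X)
      | t = t2 /\ g (t, yN N t X) <= 0].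
  move=> N; have [|t ht hg] := @clamped_IVT R (fun t => g (t, yN N t X)) t1 t2 t12.
    move=> t; apply: (@cvg_comp_pair _ _ _ _ (nbhs t) _ g id).
    - exact: cg.
    - exact: cvg_id.
    - exact: euler_continuous.
  by exists t.
move=> /choice[tN HtN].
have tN12 N : t1 <= tN N <= t2 by have [] := HtN N.
have [U [UU FU]] := @ultraFilterLemma _ (\oo : set_system nat) _.
have PU : ProperFilter U by case: UU.
have FilU : Filter U by exact: filter_filter.
have ultra_lim (T : topologicalType) (K : set T) (u : nat -> T) :
    compact K -> (forall n, K (u n)) -> exists2 l, K l & u @ U --> l.
  rewrite compact_ultra => cK Ku.
  have [|l [Kl ul]] := cK (u @ U) (fmap_ultra u UU).
    by apply: (@filterS _ U _ setT) => [n _|]; [exact: Ku|exact: filterT].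
  by exists l.
have [t ht tNt] : exists2 t, t1 <= t <= t2 & tN @ U --> t.
  have [|t] := @ultra_lim R _ tN (@segment_compact R t1 t2).
    by move=> n; rewrite /= in_itv /= tN12.
  by rewrite /= in_itv /= => ? ?; exists t.
have [B HB] : exists B : R, forall s, t1 <= s <= t2 -> `|y0 s| <= B.
  have /compact_bounded[M [_ HM]] : compact (y0 @` `[t1, t2]).
    apply: continuous_compact; last exact: segment_compact.
    exact: continuous_subspaceT.
  exists (M + 1) => s hs; apply: HM; first by rewrite ltrDl.
  by exists s => //=; rewrite in_itv.
pose G (x : R) : R := (1 + B) * expR (C * x).
have yN_bound N (x : R) k : (k <= node N x)%N -> 0 <= x ->
    1 + `|euler F y0 (step N) (tN N) k| <= G x.
  move=> kn x0.
  have := @euler_growth R V F y0 (step N) (tN N) C (ltW (step_gt0 N)) C0.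
  move=> /(_ (fun x v => growth x v (tN12 N)))/(_ k) H.
  apply: (le_trans H); apply: ler_pM; rewrite ?addr_ge0 ?expR_ge0//.
  - by rewrite lerD2l HB.
  - rewrite ler_expR ler_wpM2l//.
    have /andP[+ _] := node_itv N x0; apply: le_trans.
    by rewrite ler_wpM2r ?ler_nat// ltW.
have : forall x : R, exists yx : V, 0 <= x -> (fun N => yN N (tN N) x) @ U --> yx.
  move=> x; have [x0|x0] := leP 0 x; last by exists 0.
  have [|l _ Hl] := @ultra_lim V _ (fun N => yN N (tN N) x) (@compact_balls (G x)).
    by move=> N /=; have := yN_bound N x _ (leqnn _) x0; rewrite /yN; lra.
  by exists l.
move=> /choice[y Hy].
have near_step (e : R) : 0 < e -> \forall N \near U, step N < e.
  move=> e0; apply: FU; near=> N; rewrite /step.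
  by near: N; exact: (near_infty_natSinv_lt (PosNum e0)).
exists t, y; split => //.
- have H0 : (fun N => yN N (tN N) 0) @ U --> y0 t.
    have -> : (fun N => yN N (tN N) 0) = y0 \o tN.
      by apply/funext => N; rewrite /yN /node mul0r truncn0.
    exact: (cvg_comp _ _ tNt (@cy0 t)).
  by have := @cvg_unique V _ _ _ _ _ (Hy 0 (lexx 0)) H0; apply; exact: norm_hausdorff.
- move=> x x0 e e0.
  have : \forall z \near (t, x, y x), `|F (t, x, y x) - F z| < e.
    by have /cvgrPdist_lt := @cF (t, x, y x); exact.
  move=> /nbhs_ballP[r /= r0 Hr].
  pose L := C * G (x + 1).
  have G0 (z : R) : 0 < G z.
    rewrite /G mulr_gt0// ?expR_gt0//.
    have := HB t ht; have := normr_ge0 (y0 t); lra.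
  have L0 : 0 <= L by rewrite mulr_ge0// ltW.
  pose d := Num.min 1 (r / (4 * (L + 1))).
  have d0 : 0 < d.
    by rewrite lt_min ltr01 divr_gt0// mulr_gt0//; lra.
  exists d => // x' x'0 hx'.
  have x'1 : x' <= x + 1.
    have : `|x' - x| < 1 by apply: (lt_le_trans hx'); rewrite ge_min lexx.
    by rewrite ltr_norml; lra.
  have Lip N i n : (i + n <= node N (x + 1))%N ->
      `|euler F y0 (step N) (tN N) (i + n) - euler F y0 (step N) (tN N) i| <=
      n%:R * step N * L.
    move=> inn.
    have := @euler_increment R V F y0 (step N) (tN N) L 0 i n (ltW (step_gt0 N)).
    rewrite scaler0 subr0; apply => k /andP[_ kin]; rewrite subr0.
    apply: (le_trans (growth _ _ (tN12 N))); rewrite ler_wpM2l//.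
    by apply: yN_bound; [exact: (leq_trans (ltnW kin))|lra].
  (* between two abscissae within d of x the scheme stays close to y x, hence
     the field close to its value at (t, x, y x) *)
  have key N (a b : R) : 0 <= a -> a <= b -> b <= x + 1 -> `|a - x| < d -> `|b - x| < d ->
      (a = x \/ b = x) -> step N < d -> `|tN N - t| < r ->
      `|yN N (tN N) x - y x| < r / 4 ->
      `|yN N (tN N) b - yN N (tN N) a - (b - a) *: F (t, x, y x)| <=
        (b - a + step N) * e + step N * `|F (t, x, y x)|.
    move=> a0 ab b1 ax bx abx sd tr yr.
    have nab := node_le N ab; pose n := (node N b - node N a)%N.
    have En : node N b = (node N a + n)%N by rewrite subnKC.
    have ha := node_itv N a0; have hb := node_itv N (le_trans a0 ab).
    have hn : `|n%:R * step N - (b - a)| <= step N.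
      have En' : n%:R * step N = (node N b)%:R * step N - (node N a)%:R * step N.
        by rewrite En natrD; ring.
      by rewrite En' ler_norml; move: ha hb => /andP[? ?] /andP[? ?]; apply/andP; lra.
    have H1 : `|yN N (tN N) b - yN N (tN N) a - (n%:R * step N) *: F (t, x, y x)| <=
        n%:R * step N * e.
      rewrite /yN En; apply: euler_increment => [|k /andP[ak kb]]; first exact: ltW.
      rewrite distrC; apply/ltW/Hr.
      have kx1 : (k <= node N (x + 1))%N.
        by apply: (leq_trans (ltnW kb)); rewrite -En; exact: node_le.
      have kxx : `|k%:R * step N - x| < 2 * d.
        have h1 : (node N a)%:R * step N <= k%:R * step N.
          by rewrite ler_wpM2r ?ler_nat// ltW.
        have h2 : k%:R * step N <= (node N b)%:R * step N.
          by rewrite ler_wpM2r ?ler_nat ?En 1?ltnW// ltW.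
        move: ax bx; rewrite !ltr_norml => /andP[? ?] /andP[? ?].
        by move: ha hb => /andP[? ?] /andP[? ?]; apply/andP; lra.
      have d4 : d * (4 * (L + 1)) <= r.
        rewrite -ler_pdivlMr; last by rewrite mulr_gt0//; lra.
        by rewrite ge_min lexx orbT.
      have dr : 4 * d <= r.
        apply: le_trans d4; rewrite mulrC ler_wpM2l//; [exact: ltW|lra].
      have kyx : `|euler F y0 (step N) (tN N) k - yN N (tN N) x| <= 2 * d * L.
        rewrite /yN; have [kx|/ltnW kx] := leqP (node N x) k.
          rewrite -(subnKC kx); apply: (le_trans (Lip _ _ _ _)); first by rewrite subnKC.
          rewrite ler_wpM2r// natrB// mulrBl.
          have := node_itv N x0; move: kxx; rewrite ltr_norml => /andP[? ?] /andP[? ?].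
          have bx' : k%:R * step N <= (node N b)%:R * step N - step N.
            rewrite lerBrDr -[X in _ + X]mul1r -mulrDl natr1 ler_wpM2r//.
              exact: ltW.
            by rewrite ler_nat En.
          by move: bx hb; rewrite ltr_norml => /andP[? ?] /andP[? ?]; lra.
        rewrite distrC -(subnKC kx); apply: (le_trans (Lip _ _ _ _)).
          by rewrite subnKC//; apply: node_le; lra.
        rewrite ler_wpM2r// natrB// mulrBl.
        have := node_itv N x0; move: kxx; rewrite ltr_norml => /andP[? ?] /andP[? ?].
        by lra.
      split; first split => /=.
      - by rewrite -ball_normE /= distrC.
      - by rewrite -ball_normE /= distrC; apply: (lt_le_trans kxx); lra.
      - rewrite /=; rewrite -ball_normE /= distrC.
        rewrite -(subrK (yN N (tN N) x) (euler _ _ _ _ _)) -addrA.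
        apply: (le_lt_trans (ler_normD _ _)).
        have : 2 * d * L <= r / 2 by move: d4 d0; nra.
        by move: kyx yr; lra.
    have -> : yN N (tN N) b - yN N (tN N) a - (b - a) *: F (t, x, y x) =
      (yN N (tN N) b - yN N (tN N) a - (n%:R * step N) *: F (t, x, y x)) +
      (n%:R * step N - (b - a)) *: F (t, x, y x).
      by rewrite [in RHS]scalerBl addrA subrK.
    apply: (le_trans (ler_normD _ _)); apply: lerD.
      apply: (le_trans H1); rewrite ler_wpM2r//; first exact: ltW.
      by move: hn; rewrite ler_norml => /andP[? ?]; lra.
    by rewrite normrZ ler_wpM2r.
  apply/ler_addgt0Pl => eta eta0.
  set W := F (t, x, y x) in key *.
  pose s := eta / (3 * (e + `|W| + 1)).
  have s0 : 0 < s by rewrite divr_gt0// mulr_gt0//; have := normr_ge0 W; lra.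
  have : \forall N \near U, [/\ step N < Num.min d s, `|tN N - t| < r,
      `|yN N (tN N) x - y x| < Num.min (r / 4) (eta / 3) &
      `|yN N (tN N) x' - y x'| < eta / 3].
    near=> N; split; near: N.
    - by apply: near_step; rewrite lt_min d0.
    - by move/cvgrPdist_lt: tNt => /(_ r r0); apply: filterS => N; rewrite distrC.
    - have /cvgrPdist_lt/(_ (Num.min (r / 4) (eta / 3))) := Hy x x0.
      rewrite lt_min !divr_gt0// => /(_ isT).
      by apply: filterS => N; rewrite distrC.
    - have /cvgrPdist_lt/(_ (eta / 3)) := Hy x' x'0.
      rewrite !divr_gt0// => /(_ isT).
      by apply: filterS => N; rewrite distrC.
  move=> /filter_ex[N []]; rewrite !lt_min => /andP[sd ss] tr /andP[yr ye] y'e.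
  have xx : `|x - x| < d by rewrite subrr normr0.
  have sm : step N * e + step N * `|W| <= eta / 3.
    have : s * (3 * (e + `|W| + 1)) = eta.
      by rewrite /s divfK//; have := normr_ge0 W; lra.
    by move: ss (step_gt0 N) (normr_ge0 W) e0; nra.
  have H : `|yN N (tN N) x' - yN N (tN N) x - (x' - x) *: W| <=
      `|x' - x| * e + step N * e + step N * `|W|.
    have [xx'|/ltW xx'] := leP x x'.
      rewrite (@ger0_norm _ (x' - x)) ?subr_ge0// -mulrDl.
      apply: key => //; [by left|by rewrite lt_min].
    have -> : yN N (tN N) x' - yN N (tN N) x - (x' - x) *: W =
        - (yN N (tN N) x - yN N (tN N) x' - (x - x') *: W).
      by rewrite -[x - x']opprB scaleNr opprK opprD opprB.
    rewrite normrN (@ler0_norm _ (x' - x)) ?subr_le0// opprB -mulrDl.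
    apply: key => //; [lra|by right|by rewrite lt_min].
  have -> : y x' - y x - (x' - x) *: W =
     (yN N (tN N) x' - yN N (tN N) x - (x' - x) *: W) +
     (yN N (tN N) x - y x) - (yN N (tN N) x' - y x').
    set a := yN N _ x'; set b := yN N _ x; set c := _ *: W.
    rewrite opprB (addrAC a) (addrA _ b) subrK [RHS]addrC -(addrA a) addrA subrK.
    by rewrite addrA addrAC.
  apply: (le_trans (ler_normB _ _)).
  have := ler_normD (yN N (tN N) x' - yN N (tN N) x - (x' - x) *: W) (yN N (tN N) x - y x).
  by move: H sm ye y'e; lra.
- have cgN : (fun N => g (tN N, yN N (tN N) X)) @ U --> g (t, y X).
    apply: (@cvg_comp_pair _ _ _ _ U _ g tN); [exact: cg|exact: tNt|exact: Hy].
  pose A1 := [set N | g (tN N, yN N (tN N) X) = 0].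
  pose A2 := [set N | tN N = t1 /\ 0 <= g (tN N, yN N (tN N) X)].
  pose A3 := [set N | tN N = t2 /\ g (tN N, yN N (tN N) X) <= 0].
  have HA N : [\/ A1 N, A2 N | A3 N] by have [_] := HtN N.
  have [UA1|UA1] := @in_ultra_setVsetC _ U A1 UU.
    apply: Or31; apply/eqP; rewrite -(@cvg_unique _ _ _ _ _ _ cgN (_ : _ --> 0)) //.
    apply: cvg_near_cst; exact: UA1.
  have [UA2|UA2] := @in_ultra_setVsetC _ U A2 UU.
    apply: Or32; split.
      apply/eqP; rewrite (@cvg_unique _ _ _ _ _ _ tNt (_ : _ --> t1)) //.
      by apply: cvg_near_cst; apply: filterS UA2 => N [].
    by apply: (@cvgr_to_ge _ _ _ _ _ _ _ cgN); apply: filterS UA2 => N [].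
  have UA3 : U A3.
    near=> N; have [h|h|//] := HA N.
    - by exfalso; move: h; near: N; exact: UA1.
    - by exfalso; move: h; near: N; exact: UA2.
  apply: Or33; split.
    apply/eqP; rewrite (@cvg_unique _ _ _ _ _ _ tNt (_ : _ --> t2)) //.
    by apply: cvg_near_cst; apply: filterS UA3 => N [].
  by apply: (@cvgr_to_le _ _ _ _ _ _ _ cgN); apply: filterS UA3 => N [].
Unshelve. all: by end_near. Qed.

End shooting.

(** * Real derivatives and the function |u|^(p-1) u *)

Section real_derivatives.
Context {R : realType}.
Implicit Types (f g : R -> R) (x a b : R).

Lemma is_derive_addf f g x a b : is_derive x 1 f a -> is_derive x 1 g b ->
  is_derive x 1 (fun y => f y + g y) (a + b).
Proof. by move=> ? ?; exact: is_deriveD. Qed.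

Lemma is_derive_oppf f x a : is_derive x 1 f a ->
  is_derive x 1 (fun y => - f y) (- a).
Proof. by move=> ?; exact: is_deriveN. Qed.

Lemma is_derive_subf f g x a b : is_derive x 1 f a -> is_derive x 1 g b ->
  is_derive x 1 (fun y => f y - g y) (a - b).
Proof. by move=> ? ?; exact: is_deriveB. Qed.

Lemma is_derive_mulf f g x a b : is_derive x 1 f a -> is_derive x 1 g b ->
  is_derive x 1 (fun y => f y * g y) (a * g x + f x * b).
Proof.
move=> fa gb; suff -> : a * g x + f x * b = f x *: b + g x *: a.
  exact: is_deriveM.
by rewrite /GRing.scale /=; ring.
Qed.

Lemma is_derive_scalef k f x a : is_derive x 1 f a ->
  is_derive x 1 (fun y => k * f y) (k * a).
Proof.
move=> fa; have := is_derive_mulf (is_derive_cst k x 1) fa.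
by rewrite mul0r add0r.
Qed.

Lemma is_derive_sqrf f x a : is_derive x 1 f a ->
  is_derive x 1 (fun y => f y ^+ 2) (2 * f x * a).
Proof.
move=> fa; suff -> : 2 * f x * a = a * f x + f x * a.
  exact: is_derive_mulf.
by ring.
Qed.

Lemma is_derive_compf f g x a b : is_derive (f x) 1 g b -> is_derive x 1 f a ->
  is_derive x 1 (fun y => g (f y)) (b * a).
Proof. by move=> gb fa; exact: is_derive1_comp. Qed.

Lemma is_derive_continuous f x a : is_derive x 1 f a -> {for x, continuous f}.
Proof.
by move=> fa; exact/differentiable_continuous/derivable1_diffP/ex_derive.
Qed.

Lemma is_derive_epsP f x l :
  (forall e : R, 0 < e -> exists2 d : R, 0 < d & forall y : R, `|y - x| < d ->
     `|f y - f x - (y - x) * l| <= e * `|y - x|) ->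
  is_derive x 1 f l.
Proof.
move=> H; have lim : (fun h => h^-1 *: (f (h *: 1 + x) - f x)) @ 0^' --> l.
  apply/cvgrPdist_le => e e0; have [d d0 Hd] := H e e0.
  rewrite near_withinE; apply/nbhs_ballP; exists d => // h.
  rewrite -ball_normE /= sub0r normrN => hd h0.
  have := Hd (h + x); rewrite addrK => /(_ hd) H1.
  rewrite /GRing.scale /= mulr1.
  have -> : l - h^-1 * (f (h + x) - f x) = - (h^-1 * (f (h + x) - f x - h * l)).
    by field.
  rewrite normrN normrM normfV ler_pdivrMl ?normr_gt0//.
  by rewrite [leRHS]mulrC.
apply: DeriveDef; first by apply/cvg_ex; exists l; exact: lim.
exact: (cvg_lim _ lim).
Qed.

End real_derivatives.

Section monotonicity.
Context {R : realType}.
Implicit Types (f df : R -> R) (a b K : R).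

Lemma derive_ge0_le f df a b : a <= b ->
  {within `[a, b], continuous f} ->
  (forall x, a < x < b -> is_derive x 1 f (df x)) ->
  (forall x, a < x < b -> 0 <= df x) -> f a <= f b.
Proof.
rewrite le_eqVlt => /predU1P[->//|ab] cf Hf df0.
have Hf' x : x \in `]a, b[ -> is_derive x 1 f (df x) by rewrite in_itv; exact: Hf.
have [c] := MVT ab Hf' cf.
rewrite in_itv /= => cab fab; rewrite -subr_ge0 fab mulr_ge0 ?df0//.
by rewrite subr_ge0 ltW.
Qed.

(** The function f(x) e^(-K (x - a)) is nonincreasing. *)
Lemma gronwall_le f df K a b : a <= b ->
  {within `[a, b], continuous f} ->
  (forall x, a < x < b -> is_derive x 1 f (df x)) ->
  (forall x, a < x < b -> df x <= K * f x) -> f b <= f a * expR (K * (b - a)).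
Proof.
move=> ab cf Hf dfK.
pose g x := - (f x * expR (- (K * (x - a)))).
have dexp (x : R) : is_derive x 1 (fun x => expR (- (K * (x - a))))
    (expR (- (K * (x - a))) * (- (K * (1 - 0)))).
  apply: (is_derive_compf (is_derive_expR _)).
have : g a <= g b.
  apply: (@derive_ge0_le _ (fun x => - (df x * expR (- (K * (x - a))) +
    f x * (expR (- (K * (x - a))) * (- (K * (1 - 0)))))) _ _ ab).
  - move=> x; apply: cvgN; apply: cvgM; first exact: cf.
    by apply: continuous_subspaceT => y; exact: is_derive_continuous (dexp y).
  - move=> x xab; apply: is_derive_oppf; apply: is_derive_mulf => //.
    exact: Hf.
  - move=> x xab; have -> : - (df x * expR (- (K * (x - a))) +
      f x * (expR (- (K * (x - a))) * (- (K * (1 - 0))))) =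
      (K * f x - df x) * expR (- (K * (x - a))) by ring.
    by rewrite mulr_ge0 ?expR_ge0// subr_ge0 dfK.
rewrite /g lerN2 subrr mulr0 oppr0 expR0 mulr1 expRN.
by rewrite ler_pdivrMr ?expR_gt0.
Qed.

End monotonicity.

Section signed_power.
Context {R : realType}.
Variable p : R.
Hypothesis hp : 0 < p < 1.

Definition spow (u : R) : R := `|u| `^ (p - 1) * u.

Let p0 : 0 < p. Proof. by case/andP: hp. Qed.

Lemma powR_norm_mul (u : R) : `|u| * `|u| `^ p = `|u| `^ (p + 1).
Proof.
rewrite -(@mulr_powRB1 R `|u| (p + 1)) ?addrK//; have := p0; lra.
Qed.

Lemma norm_spow (u : R) : `|spow u| = `|u| `^ p.
Proof.
by rewrite /spow normrM norm_powR// normr_id mulrC mulr_powRB1.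
Qed.

Lemma mul_spow (u : R) : u * spow u = `|u| `^ (p + 1).
Proof.
rewrite -powR_norm_mul -(mulr_powRB1 (normr_ge0 u) p0) /spow.
by rewrite mulrCA -expr2 -real_normK ?num_real// expr2; ring.
Qed.

Lemma spow0 : spow 0 = 0.
Proof. by rewrite /spow mulr0. Qed.

Lemma powR_small (e : R) : 0 < e -> exists2 d : R, 0 < d & forall u : R, `|u| < d -> `|u| `^ p <= e.
Proof.
move=> e0; exists (e `^ p^-1); first exact: powR_gt0.
move=> u ud; have -> : e = (e `^ p^-1) `^ p.
  by rewrite -powRrM mulVf ?gt_eqF// powRr1// ltW.
apply: ge0_ler_powR; rewrite ?nnegrE ?powR_ge0//; exact: ltW.
Qed.

(** At u = 0 the derivative exists because p is positive; this is what makes the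
    energy below differentiable although spow is not Lipschitz at 0. *)
Lemma is_derive_powR_norm (u : R) :
  is_derive u 1 (fun v => `|v| `^ (p + 1)) ((p + 1) * spow u).
Proof.
have [u0|u0|->] := ltgtP u 0.
- apply: (@near_eq_is_derive _ _ _ (fun v => (- v) `^ (p + 1))).
    by near=> v; rewrite ltr0_norm//; near: v; exact: lt_nbhsl.
  have nu : 0 < - u by rewrite oppr_gt0.
  suff -> : (p + 1) * spow u = (p + 1) * (- u) `^ (p + 1 - 1) * (- 1).
    exact: (is_derive_compf (is_derive1_powR (p + 1) nu) (is_derive_oppf (is_derive_id u 1))).
  rewrite addrK /spow ltr0_norm// -(mulr_powRB1 (ltW nu) p0); ring.
- apply: (@near_eq_is_derive _ _ _ (fun v => v `^ (p + 1))).
    by near=> v; rewrite gtr0_norm//; near: v; exact: lt_nbhsr.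
  suff -> : (p + 1) * spow u = (p + 1) * u `^ (p + 1 - 1).
    exact: is_derive1_powR.
  by rewrite addrK /spow gtr0_norm// -(mulr_powRB1 (ltW u0) p0); ring.
- rewrite spow0 mulr0; apply: is_derive_epsP => e e0.
  have [d d0 Hd] := powR_small e0; exists d => // y.
  rewrite subr0 normr0 powR0 ?gt_eqF; last by have := p0; lra.
  move=> yd; rewrite subr0 mulr0 subr0 -powR_norm_mul ger0_norm.
    by rewrite mulrC ler_wpM2r// Hd.
  by rewrite mulr_ge0// powR_ge0.
Unshelve. all: by end_near. Qed.

Lemma continuous_powR_norm : continuous (fun v : R => `|v| `^ (p + 1)).
Proof. by move=> u; exact: is_derive_continuous (is_derive_powR_norm u). Qed.

Lemma continuous_spow : continuous spow.
Proof.
move=> u; have [->|u0] := eqVneq u 0.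
  rewrite /continuous_at spow0; apply/cvgrPdist_le => e e0.
  have [d d0 Hd] := powR_small e0.
  exists d => // v; rewrite /ball_ /= sub0r normrN => vd.
  by rewrite sub0r normrN norm_spow Hd.
apply: (@cvg_trans _ ((fun v => `|v| `^ (p + 1) / v) @ u)); last first.
  rewrite (_ : spow u = `|u| `^ (p + 1) / u).
    apply: (@cvgM R R (nbhs u) _ (fun v => `|v| `^ (p + 1)) (fun v => v^-1)).
      exact: continuous_powR_norm.
    by apply: cvgV => //; exact: cvg_id.
  by rewrite -mul_spow mulrAC divff// mul1r.
apply: near_eq_cvg; near=> v.
have v0 : v != 0.
  near: v; exists `|u|; first by rewrite /= normr_gt0.
  by move=> v /=; apply: contraTneq => ->; rewrite subr0 ltxx.
by rewrite -mul_spow mulrAC divff// mul1r.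
Unshelve. all: by end_near. Qed.

Lemma powR_norm_le (u : R) : `|u| `^ p <= 1 + `|u|.
Proof.
have [u1|u1] := leP `|u| 1.
  have := @ge0_ler_powR R p (ltW p0) `|u| 1; rewrite powR1 !nnegrE normr_ge0 ler01.
  by move=> /(_ isT isT u1) => h; apply: (le_trans h); rewrite lerDl.
apply: (@le_trans _ _ `|u|); last by rewrite lerDr.
by apply: ler1_powR; [exact: ltW|case/andP: hp => _ /ltW].
Qed.

(** Sublinearity: the smaller the amplitude M, the stiffer the restoring force
    relative to u. *)
Lemma powR_norm_ge (M u : R) : 0 < M -> `|u| <= M ->
  M `^ (p - 1) * u ^+ 2 <= `|u| `^ (p + 1).
Proof.
move=> M0 uM; have [->|u0] := eqVneq u 0.
  by rewrite expr0n /= mulr0 powR_ge0.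
have nu0 : 0 < `|u| by rewrite normr_gt0.
rewrite -mul_spow /spow -[in leRHS]mulrCA -expr2.
rewrite ler_wpM2r ?sqr_ge0//.
have -> : p - 1 = - (1 - p) by ring.
rewrite !powRN lef_pV2 ?posrE ?powR_gt0//.
apply: ge0_ler_powR; rewrite ?nnegrE//; first by case/andP: hp; lra.
exact: ltW.
Qed.

(** The homogeneity that turns small amplitudes s into high frequencies. *)
Lemma spowM (s u : R) : 0 < s -> spow (s * u) = s `^ (p - 1) * s * spow u.
Proof.
by move=> s0; rewrite /spow normrM powRM// (gtr0_norm s0); ring.
Qed.

End signed_power.

(** * Continuity of real functions and clamping *)

Section continuous_real_functions.
Context {R : realType} {T : topologicalType}.
Implicit Types f g : T -> R.

Lemma continuous_mulf f g : continuous f -> continuous g ->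
  continuous (fun z => f z * g z).
Proof. by move=> cf cg z; apply: cvgM; [exact: cf|exact: cg]. Qed.

Lemma continuous_addf f g : continuous f -> continuous g ->
  continuous (fun z => f z + g z).
Proof. by move=> cf cg z; apply: cvgD; [exact: cf|exact: cg]. Qed.

Lemma continuous_oppf f : continuous f -> continuous (fun z => - f z).
Proof. by move=> cf z; apply: cvgN; exact: cf. Qed.

Lemma continuous_invf f : (forall z, f z != 0) -> continuous f ->
  continuous (fun z => (f z)^-1).
Proof. by move=> f0 cf z; apply: cvgV => //; exact: cf. Qed.

Lemma continuous_compf (S : topologicalType) (f : T -> S) (g : S -> R) :
  continuous f -> continuous g -> continuous (fun z => g (f z)).
Proof. by move=> cf cg z; apply: continuous_comp; [exact: cf|exact: cg]. Qed.

Lemma continuous_maxf f (c : R) : continuous f ->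
  continuous (fun z => Num.max (f z) c).
Proof.
by move=> cf z; apply: (@continuous_max _ _ f (cst c)); [exact: cf|exact: cvg_cst].
Qed.

End continuous_real_functions.

Section clamping.
Context {R : realType}.
Variable X : R.
Hypothesis X0 : 0 < X.

Definition clamp (x : R) : R := Num.max (Num.min x X) 0.

Lemma clamp_itv x : 0 <= clamp x <= X.
Proof. by rewrite /clamp le_max lexx orbT ge_max ge_min lexx orbT ltW. Qed.

Lemma clamp_id x : 0 <= x <= X -> clamp x = x.
Proof. by case/andP=> x0 xX; rewrite /clamp min_l// max_l. Qed.

Lemma continuous_clamp : continuous clamp.
Proof.
apply: continuous_maxf => x.
by apply: (@continuous_min _ _ id (cst X)); [exact: cvg_id|exact: cvg_cst].
Qed.

(** The coefficients live on [0, X], while the Euler scheme wants a field that is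
    continuous everywhere. *)
Lemma continuous_comp_clamp (f : R -> R) : {within `[0, X], continuous f} ->
  continuous (fun x => f (clamp x)).
Proof.
move=> /subspace_continuousP cf x.
have cx : `[0, X]%classic (clamp x) by rewrite /= in_itv /= clamp_itv.
apply: (cvg_comp clamp f _ (cf _ cx)).
move=> A; rewrite /= nbhs_simpl /within /= => HA.
have := continuous_clamp HA; rewrite nbhs_simpl /=.
by apply: filterS => y /=; apply; rewrite /= in_itv /= clamp_itv.
Qed.

End clamping.

(** * A priori bounds in the phase plane *)

Section shooting_problem.
Context {R : realType}.
Implicit Types x : R.
Variables (p mu X c1 c2 r0 r1 D : R) (rho rho1 : R -> R).
Hypothesis hp : 0 < p < 1.
Hypothesis X0 : 0 < X.
Hypotheses (crho : {within `[0, X], continuous rho})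
  (drho : forall x, 0 < x < X -> is_derive x 1 rho (rho1 x)).
Hypotheses (r00 : 0 < r0)
  (rho_itv : forall x, 0 <= x <= X -> r0 <= rho x <= r1)
  (rho1_le : forall x, 0 <= x <= X -> `|rho1 x| <= D).

Notation f := (spow p).

(** The equation -(rho u')' = rho (mu u + |u|^(p-1) u) in the variables
    u = s U, rho u' = s k V, where k^2 = s^(p-1): as the amplitude s decreases
    to 0 the frequency k increases to infinity, while the initial value of (U, V)
    tends to (1, 0). *)
Definition dU (k : R) (r V : R) : R := k * V / r.
Definition dV (k : R) (r U : R) : R := - (r * (k * f U + mu * U / k)).

(** The rate of the polar angle of (U, -V), to be integrated as a third unknown.
    The truncation by q keeps the field continuous at the origin; it is inactive
    along the solutions of interest. *)
Definition dth (q k r U V : R) : R :=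
  (dU k r V * V - U * dV k r U) / Num.max (U ^+ 2 + V ^+ 2) q.

Definition phase_solution (q k : R) (U V th : R -> R) : Prop :=
  [/\ [/\ {within `[0, X], continuous U}, {within `[0, X], continuous V}
        & {within `[0, X], continuous th}],
      [/\ U 0 = 1, V 0 = - (c1 / k) & th 0 = atan (c1 / k)]
    & forall x, 0 < x < X ->
      [/\ is_derive x 1 U (dU k (rho x) (V x)),
          is_derive x 1 V (dV k (rho x) (U x))
        & is_derive x 1 th (dth q k (rho x) (U x) (V x))] ].

Let r1_gt0 : 0 < r1.
Proof.
have /andP[h1 h2] : r0 <= rho 0 <= r1 by apply: rho_itv; rewrite lexx ltW.
by apply: lt_le_trans r00 _; exact: le_trans h2.
Qed.

Let sqr_le (u v : R) : 0 <= u -> u <= v -> u ^+ 2 <= v ^+ 2.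
Proof. by move=> u0 uv; rewrite !expr2 ler_pM. Qed.

Let D_ge0 : 0 <= D.
Proof.
by apply: le_trans (rho1_le (_ : 0 <= 0 <= X)); [exact: normr_ge0|rewrite lexx ltW].
Qed.

Let ooW (x : R) : 0 < x < X -> 0 <= x <= X.
Proof. by case/andP=> /ltW -> /ltW ->. Qed.

Section a_priori_bounds.
Variables (q k : R) (U V th : R -> R).
Hypothesis k1 : 1 <= k.
Hypothesis sol : phase_solution q k U V th.

Let k0 : 0 < k. Proof. exact: lt_le_trans k1. Qed.

Let p0 : 0 < p. Proof. by case/andP: hp. Qed.

Definition energy x : R := 2^-1 * V x ^+ 2 +
  rho x ^+ 2 * ((p + 1)^-1 * `|U x| `^ (p + 1) + (2 * k ^+ 2)^-1 * U x ^+ 2).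

Definition energy_rate : R := `|1 - mu| + 2 * D / r0.

Let denergy (x : R) : R := (1 - mu) * (rho x * U x * V x / k) +
  2 * rho1 x * rho x *
    ((p + 1)^-1 * `|U x| `^ (p + 1) + (2 * k ^+ 2)^-1 * U x ^+ 2).

(** The terms of order k cancel, so that the energy varies at a rate that does
    not depend on k. *)
Lemma is_derive_energy x : 0 < x < X -> is_derive x 1 energy (denergy x).
Proof.
move=> xX; have [_ _ /(_ x xX)[U' V' _]] := sol.
have rx0 : 0 < rho x.
  by have /andP[/(lt_le_trans r00)] := rho_itv (ooW xX).
have : denergy x = 2^-1 * (2 * V x * dV k (rho x) (U x)) +
   ((2 * rho x * rho1 x) * ((p + 1)^-1 * `|U x| `^ (p + 1) + (2 * k ^+ 2)^-1 * U x ^+ 2)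
    + rho x ^+ 2 * ((p + 1)^-1 * ((p + 1) * f (U x) * dU k (rho x) (V x)) +
        (2 * k ^+ 2)^-1 * (2 * U x * dU k (rho x) (V x)))).
  rewrite /denergy /dU /dV; field; do ?[apply/andP; split]; rewrite ?gt_eqF//.
  by have := p0; lra.
move=> ->.
apply: is_derive_addf; first by apply/is_derive_scalef/is_derive_sqrf.
apply: is_derive_mulf; first by apply/is_derive_sqrf/drho.
apply: is_derive_addf; apply: is_derive_scalef; last exact: is_derive_sqrf.
exact: (is_derive_compf (is_derive_powR_norm hp (U x)) U').
Qed.

Let powU_ge0 x : 0 <= `|U x| `^ (p + 1). Proof. exact: powR_ge0. Qed.

Let ip1 : 2^-1 <= (p + 1)^-1 <= 1.
Proof.
have := hp; move=> /andP[p_0 p_1]; apply/andP; split.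
  by rewrite lef_pV2 ?posrE; lra.
by rewrite invf_le1; lra.
Qed.

Let energy_ge x : 0 <= x <= X ->
  2 * `|rho x * U x * V x / k| <= 2 * energy x /\
  2 * D / r0 * energy x >= `|2 * rho1 x * rho x *
    ((p + 1)^-1 * `|U x| `^ (p + 1) + (2 * k ^+ 2)^-1 * U x ^+ 2)|.
Proof.
move=> xX; set a := _ + _; have /andP[rx _] := rho_itv xX.
have rx0 : 0 < rho x by exact: lt_le_trans rx.
have ikk : 0 < (2 * k ^+ 2)^-1 by rewrite invr_gt0 mulr_gt0// exprn_gt0.
have h1 : 0 <= (p + 1)^-1 * `|U x| `^ (p + 1).
  by rewrite mulr_ge0//; case/andP: ip1; lra.
have h2 : 0 <= (2 * k ^+ 2)^-1 * U x ^+ 2.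
  by rewrite mulr_ge0 ?sqr_ge0// ltW.
have a0 : 0 <= a by rewrite addr_ge0.
split.
  have e1 : (rho x * U x / k) ^+ 2 = 2 * (rho x ^+ 2 * ((2 * k ^+ 2)^-1 * U x ^+ 2)).
    by field; rewrite gt_eqF.
  have e2 : rho x * U x * V x / k = (rho x * U x / k) * V x by ring.
  have e3 : 0 <= rho x ^+ 2 * ((p + 1)^-1 * `|U x| `^ (p + 1)).
    by rewrite mulr_ge0 ?sqr_ge0.
  rewrite e2 /energy mulrDr; move: e1 e3; set b := rho x * U x / k => e1 e3.
  have : `|b * V x| <= 2^-1 * (b ^+ 2 + V x ^+ 2).
    have := sqr_ge0 (b - V x); have := sqr_ge0 (b + V x).
    by rewrite !expr2 => s1 s2; rewrite ler_norml; apply/andP; split; lra.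
  by move: e1 e3; rewrite !mulrDr; lra.
rewrite normrM (ger0_norm a0) !normrM (gtr0_norm rx0) ger0_norm//.
have h3 : rho x ^+ 2 * a <= energy x.
  by rewrite /energy lerDr mulr_ge0 ?sqr_ge0// invr_ge0.
have h4 : rho x * a <= energy x / r0.
  rewrite ler_pdivlMr//; apply: le_trans h3; rewrite expr2 -!mulrA.
  by apply: ler_wpM2l; [exact: ltW|rewrite mulrC ler_wpM2r].
have h5 := rho1_le xX.
have h6 : `|rho1 x| * (rho x * a) <= D * (energy x / r0).
  by apply: ler_pM => //; rewrite mulr_ge0// ltW.
by move: h6; rewrite (_ : 2 * D / r0 * _ = 2 * (D * (energy x / r0))); [lra|ring].
Qed.

Let denergy_le x : 0 < x < X -> `|denergy x| <= energy_rate * energy x.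
Proof.
move=> xX; have [h1 h2] := energy_ge (ooW xX).
rewrite /denergy /energy_rate [leRHS]mulrDl; apply: (le_trans (ler_normD _ _)).
apply: lerD => //; rewrite normrM ler_wpM2l//; lra.
Qed.

Let continuous_energy : {within `[0, X], continuous energy}.
Proof.
have [[cU cV _] _ _] := sol.
move=> x; apply: cvgD.
  by apply: cvgM; [exact: cvg_cst|apply: cvgM; exact: cV].
apply: cvgM; first by apply: cvgM; exact: crho.
apply: cvgD; apply: cvgM; try exact: cvg_cst; last by apply: cvgM; exact: cU.
apply: (cvg_comp U (fun v => `|v| `^ (p + 1)) (cU x)).
exact: continuous_powR_norm.
Qed.

Lemma energy_bounds x : 0 <= x <= X ->
  energy 0 * expR (- (energy_rate * X)) <= energy x <=
  energy 0 * expR (energy_rate * X).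
Proof.
case/andP => x0 xX.
have K0 : 0 <= energy_rate.
  by rewrite /energy_rate addr_ge0// divr_ge0 ?(ltW r00)// mulr_ge0.
have E0 : 0 <= energy 0.
  have [|h _] := @energy_ge 0; first by rewrite lexx ltW.
  by have := normr_ge0 (rho 0 * U 0 * V 0 / k); lra.
have cE : {within `[0, x], continuous energy}.
  apply: continuous_subspaceW continuous_energy.
  by apply: subset_itvl; rewrite bnd_simp.
have inX y : 0 < y < x -> 0 < y < X.
  by case/andP => -> yx /=; exact: lt_le_trans xX.
apply/andP; split.
  have := @gronwall_le _ (fun y => - energy y) (fun y => - denergy y) (- energy_rate) _ _ x0.
  rewrite subr0 mulNr lerN2 => H.
  have : energy 0 * expR (- energy_rate * x) <= energy x.
    apply: H => [y|y yx|y yx]; first by apply: cvgN; exact: cE.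
      exact/is_derive_oppf/is_derive_energy/inX.
    rewrite mulrNN; have := denergy_le (inX y yx).
    by rewrite ler_norml => /andP[]; lra.
  apply: le_trans; rewrite ler_wpM2l// ler_expR mulNr lerN2.
  by rewrite ler_wpM2l.
have := @gronwall_le _ energy denergy energy_rate _ _ x0.
rewrite subr0 => H; apply: (@le_trans _ _ (energy 0 * expR (energy_rate * x))).
  apply: H => // y yx; first exact/is_derive_energy/inX.
  by have := denergy_le (inX y yx); rewrite ler_norml => /andP[].
by rewrite ler_wpM2l// ler_expR ler_wpM2l.
Qed.

(** Only k >= 1 enters these bounds: they have to serve all frequencies. *)
Definition energy_lo : R := r0 ^+ 2 / 2 * expR (- (energy_rate * X)).
Definition energy_hi : R :=
  (c1 ^+ 2 / 2 + 2 * r1 ^+ 2) * expR (energy_rate * X).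

Lemma energy_itv x : 0 <= x <= X -> energy_lo <= energy x <= energy_hi.
Proof.
move=> /energy_bounds/andP[h1 h2].
have [_ [U0 V0 _] _] := sol.
have /andP[lo hi] : r0 <= rho 0 <= r1 by apply: rho_itv; rewrite lexx ltW.
have /andP[i1 i2] := ip1.
have ik : 0 <= (2 * k ^+ 2)^-1 <= 2^-1.
  rewrite invr_ge0 mulr_ge0 ?sqr_ge0//= lef_pV2 ?posrE ?mulr_gt0 ?exprn_gt0//.
  by rewrite ler_peMr// exprn_ege1.
have ck : (c1 / k) ^+ 2 <= c1 ^+ 2.
  rewrite expr_div_n ler_pdivrMr ?exprn_gt0// ler_peMr ?sqr_ge0//.
  by rewrite exprn_ege1.
have q1 : r0 ^+ 2 <= rho 0 ^+ 2 by apply: sqr_le => //; exact: ltW.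
have q2 : rho 0 ^+ 2 <= r1 ^+ 2.
  by apply: sqr_le => //; apply: le_trans lo; exact: ltW.
have q0 := sqr_ge0 r0; have c0 := sqr_ge0 (c1 / k).
have : r0 ^+ 2 / 2 <= energy 0 <= c1 ^+ 2 / 2 + 2 * r1 ^+ 2.
  rewrite /energy U0 V0 normr1 powR1 expr1n sqrrN !mulr1.
  case/andP: ik => ik0 ik2.
  apply/andP; split; first by move: ck q1 q2 c0 q0; nra.
  have : rho 0 ^+ 2 * ((p + 1)^-1 + (2 * k ^+ 2)^-1) <= r1 ^+ 2 * 2.
    by apply: ler_pM; rewrite ?sqr_ge0//; lra.
  by lra.
move=> /andP[e1 e2]; apply/andP; split.
  by apply: le_trans h1; rewrite ler_wpM2r ?expR_ge0.
by apply: (le_trans h2); rewrite ler_wpM2r ?expR_ge0.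
Qed.

Definition ampl_hi : R := 1 + 2 * energy_hi / r0 ^+ 2.
Definition ampl_lo : R := Num.min 1 (energy_lo / (1 + 2 * r1 ^+ 2)).

Lemma ampl_lo_gt0 : 0 < ampl_lo.
Proof.
rewrite lt_min ltr01/= divr_gt0//; last by have := sqr_ge0 r1; lra.
by rewrite mulr_gt0 ?expR_gt0// divr_gt0 ?exprn_gt0.
Qed.

Lemma solution_bounds x : 0 <= x <= X ->
  [/\ `|U x| <= ampl_hi, `|U x| `^ (p + 1) <= ampl_hi,
      V x ^+ 2 <= 2 * energy_hi & ampl_lo ^+ 2 <= U x ^+ 2 + V x ^+ 2].
Proof.
move=> xX; have /andP[e1 e2] := energy_itv xX.
have /andP[lo hi] := rho_itv xX.
have /andP[i1 i2] := ip1.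
have h0 : 0 <= (2 * k ^+ 2)^-1 * U x ^+ 2.
  by rewrite mulr_ge0 ?sqr_ge0// invr_ge0 mulr_ge0 ?sqr_ge0.
have q1 : r0 ^+ 2 <= rho x ^+ 2 by apply: sqr_le => //; exact: ltW.
have q2 : rho x ^+ 2 <= r1 ^+ 2.
  by apply: sqr_le => //; apply: le_trans lo; exact: ltW.
have r02 : 0 < r0 ^+ 2 by rewrite exprn_gt0.
have P0 := powU_ge0 x.
have V0 := sqr_ge0 (V x).
have HP : `|U x| `^ (p + 1) <= 2 * energy_hi / r0 ^+ 2.
  rewrite ler_pdivlMr//.
  have : r0 ^+ 2 * (2^-1 * `|U x| `^ (p + 1)) <=
    rho x ^+ 2 * ((p + 1)^-1 * `|U x| `^ (p + 1) + (2 * k ^+ 2)^-1 * U x ^+ 2).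
    apply: ler_pM => //; first exact: ltW.
    by rewrite ler_wpDr// ler_wpM2r.
  by move: e2; rewrite /energy; lra.
split.
- rewrite /ampl_hi; have [u1|u1] := leP `|U x| 1.
    by rewrite ler_wpDr//; apply: le_trans HP.
  apply: (@le_trans _ _ (`|U x| `^ (p + 1))); last lra.
  by apply: le1r_powR; [exact: ltW|have := p0; lra].
- by rewrite /ampl_hi; lra.
- move: e2; rewrite /energy.
  have : 0 <= rho x ^+ 2 * ((p + 1)^-1 * `|U x| `^ (p + 1) + (2 * k ^+ 2)^-1 * U x ^+ 2).
    by rewrite mulr_ge0 ?sqr_ge0// addr_ge0// mulr_ge0//; lra.
  lra.
- rewrite leNgt; apply/negP => small.
  have m0 := ampl_lo_gt0.
  have m1 : ampl_lo <= 1 by rewrite /ampl_lo ge_min lexx.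
  have mE : ampl_lo * (1 + 2 * r1 ^+ 2) <= energy_lo.
    rewrite -ler_pdivlMr; last by have := sqr_ge0 r1; lra.
    by rewrite /ampl_lo ge_min lexx orbT.
  have U2 : U x ^+ 2 < ampl_lo ^+ 2 by lra.
  have V2 : V x ^+ 2 < ampl_lo ^+ 2 by have := sqr_ge0 (U x); lra.
  have mm : ampl_lo ^+ 2 <= ampl_lo by rewrite expr2 ler_piMr// ltW.
  have Um : `|U x| < ampl_lo.
    by move: U2; rewrite -real_normK ?num_real// ltr_pXn2r// nnegrE ltW.
  have Pm : `|U x| `^ (p + 1) <= ampl_lo.
    rewrite -(powR_norm_mul hp); apply: le_trans (ltW Um).
    rewrite ler_piMr//; apply: (@le_trans _ _ (1 `^ p)); last by rewrite powR1.
    apply: ge0_ler_powR; rewrite ?nnegrE//; first exact: ltW.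
    by apply: le_trans m1; exact: ltW.
  have ik : (2 * k ^+ 2)^-1 <= 2^-1.
    rewrite lef_pV2 ?posrE ?mulr_gt0 ?exprn_gt0//.
    by rewrite ler_peMr// exprn_ege1.
  have : rho x ^+ 2 * ((p + 1)^-1 * `|U x| `^ (p + 1) + (2 * k ^+ 2)^-1 * U x ^+ 2) <=
    r1 ^+ 2 * (ampl_lo + 2^-1 * ampl_lo).
    apply: ler_pM; rewrite ?sqr_ge0//.
      by rewrite addr_ge0// mulr_ge0//; lra.
    apply: lerD.
      by apply: (le_trans _ Pm); rewrite ler_piMl.
    apply: ler_pM; rewrite ?sqr_ge0//; last lra.
    by rewrite invr_ge0 mulr_ge0 ?sqr_ge0.
  have r12 := sqr_ge0 r1.
  by move: e1; rewrite /energy; nra.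
Qed.

Hypothesis qE : q = ampl_lo ^+ 2.

Let maxE x : 0 <= x <= X ->
  Num.max (U x ^+ 2 + V x ^+ 2) q = U x ^+ 2 + V x ^+ 2.
Proof. by move=> /solution_bounds[_ _ _ h]; rewrite qE max_l. Qed.

Let radius_gt0 x : 0 <= x <= X -> 0 < U x ^+ 2 + V x ^+ 2.
Proof.
move=> /solution_bounds[_ _ _ h]; apply: lt_le_trans h.
by rewrite exprn_gt0// ampl_lo_gt0.
Qed.

(** The squared sine of the angle between (cos th, sin th) and (U, -V), that is
    (U sin th + V cos th)^2 / (U^2 + V^2), has zero derivative and vanishes
    at 0. *)
Lemma angle_tracks : U X * sin (th X) + V X * cos (th X) = 0.
Proof.
have [[cU cV cth] [U0 V0 th0] deriv] := sol.
pose P x := U x * sin (th x) + V x * cos (th x).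
pose S x := U x ^+ 2 + V x ^+ 2.
pose Q x := - (P x ^+ 2 * (S x)^-1).
have XX : 0 <= X <= X by rewrite lexx ltW.
have P0 : P 0 = 0.
  rewrite /P U0 V0 th0 mul1r.
  have c0 : cos (atan (c1 / k)) != 0.
    by rewrite gt_eqF// cos_gt0_pihalf// atan_gtNpi2 atan_ltpi2.
  by rewrite -{2}(atanK (c1 / k)) /tan mulNr divfK// subrr.
have : Q 0 <= Q X.
  apply: (@derive_ge0_le _ Q (fun=> 0) _ _ (ltW X0)) => //.
    have cP : {within `[0, X], continuous P}.
      move=> x; apply: cvgD.
        apply: cvgM; first exact: cU.
        by apply: (cvg_comp th sin (cth x)); exact: continuous_sin.
      apply: cvgM; first exact: cV.
      by apply: (cvg_comp th cos (cth x)); exact: continuous_cos.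
    have cS : {within `[0, X], continuous S}.
      by move=> x; apply: cvgD; apply: cvgM; [exact: cU|exact: cU|exact: cV|exact: cV].
    have cSm : {within `[0, X], continuous (fun x => Num.max (S x) q)}.
      move=> x; apply: (cvg_comp S (fun y => Num.max y q) (cS x)).
      by apply: (@continuous_maxf R R id q) => y; exact: cvg_id.
    have cQ : {within `[0, X], continuous (fun x => - (P x ^+ 2 * (Num.max (S x) q)^-1))}.
      move=> x; apply: cvgN; apply: cvgM; first by apply: cvgM; exact: cP.
      apply: cvgV; last exact: cSm.
      by rewrite gt_eqF// lt_max qE exprn_gt0 ?orbT// ampl_lo_gt0.
    apply: (subspace_eq_continuous _ cQ) => x; rewrite inE /= in_itv /= => xX.
    by rewrite /Q /from_subspace maxE.
  move=> x xX; have [U' V' th'] := deriv x xX.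
  have xX' := ooW xX.
  have Sx0 : S x != 0 by rewrite gt_eqF// radius_gt0.
  have dP : is_derive x 1 P
    (dU k (rho x) (V x) * sin (th x) +
       U x * (cos (th x) * dth q k (rho x) (U x) (V x)) +
     (dV k (rho x) (U x) * cos (th x) +
       V x * (- sin (th x) * dth q k (rho x) (U x) (V x)))).
    by apply: is_derive_addf; apply: is_derive_mulf.
  have dS : is_derive x 1 S (2 * U x * dU k (rho x) (V x) + 2 * V x * dV k (rho x) (U x)).
    by apply: is_derive_addf; exact: is_derive_sqrf.
  have := is_derive_oppf (is_derive_mulf (is_derive_sqrf dP) (is_deriveV Sx0 dS)).
  set d := (Y in is_derive _ _ _ Y -> _); suff -> : 0 = d by [].
  rewrite /d /GRing.scale /= /dth maxE// /P /S.
  by move: Sx0; rewrite /S => Sx0; field.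
rewrite /Q P0 expr0n /= mul0r oppr0 oppr_ge0 pmulr_lle0; last first.
  by rewrite invr_gt0 radius_gt0.
by rewrite exprn_even_le0//= => /eqP.
Qed.

Definition slope_lo : R := Num.min r1^-1 (r0 * ampl_hi `^ (p - 1)).
Definition slope_hi : R := (2 * energy_hi * k / r0 +
  r1 * (k * ampl_hi + `|mu| * ampl_hi ^+ 2)) / ampl_lo ^+ 2.

(** By sublinearity the restoring term dominates U^2, so that the angle turns at
    a speed of order k. *)
Lemma angle_slope x : 0 <= x <= X ->
  k * slope_lo - `|mu| * r1 <= dth q k (rho x) (U x) (V x) <= slope_hi.
Proof.
move=> xX; have [b1 b2 b3 b4] := solution_bounds xX.
have /andP[lo hi] := rho_itv xX.
have rx0 : 0 < rho x by exact: lt_le_trans lo.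
have S0 := radius_gt0 xX.
have m0 := ampl_lo_gt0.
have A0 : 0 < ampl_hi.
  rewrite /ampl_hi; have : 0 <= 2 * energy_hi / r0 ^+ 2; last lra.
  by rewrite divr_ge0 ?sqr_ge0// (le_trans _ b3)// sqr_ge0.
have num : dU k (rho x) (V x) * V x - U x * dV k (rho x) (U x) =
  k * (V x ^+ 2 / rho x + rho x * `|U x| `^ (p + 1)) + mu / k * (rho x * U x ^+ 2).
  by rewrite -(mul_spow hp) /dU /dV; field; rewrite !gt_eqF.
rewrite /dth maxE// num.
have U2 : U x ^+ 2 <= ampl_hi ^+ 2.
  by rewrite -[leLHS]real_normK ?num_real//; exact: sqr_le.
have mk : `|mu / k| <= `|mu|.
  rewrite normrM normfV (gtr0_norm k0) ler_piMr// invf_le1//.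
have t2 : `|mu / k * (rho x * U x ^+ 2)| <= `|mu| * (r1 * U x ^+ 2).
  rewrite normrM; apply: ler_pM => //.
  by rewrite normrM (gtr0_norm rx0) (ger0_norm (sqr_ge0 _)) ler_wpM2r ?sqr_ge0.
have i1 : r1^-1 <= (rho x)^-1 by rewrite lef_pV2 ?posrE.
have i2 : (rho x)^-1 <= r0^-1 by rewrite lef_pV2 ?posrE.
have V20 := sqr_ge0 (V x); have U20 := sqr_ge0 (U x).
have P0 := powU_ge0 x.
apply/andP; split.
  rewrite ler_pdivlMr// mulrBl.
  have t1 : slope_lo * (U x ^+ 2 + V x ^+ 2) <= V x ^+ 2 / rho x + rho x * `|U x| `^ (p + 1).
    rewrite mulrDr addrC; apply: lerD.
      by rewrite [leRHS]mulrC; apply: ler_wpM2r => //; rewrite /slope_lo ge_min i1.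
    apply: (@le_trans _ _ (r0 * ampl_hi `^ (p - 1) * U x ^+ 2)).
      by apply: ler_wpM2r => //; rewrite /slope_lo ge_min lexx orbT.
    rewrite -mulrA; apply: ler_pM => //; first exact: ltW.
      by rewrite mulr_ge0// powR_ge0.
    exact: powR_norm_ge.
  have := ler_wpM2l (ltW k0) t1; rewrite mulrA.
  move: t2; rewrite ler_norml => /andP[t2 _].
  have : `|mu| * (r1 * U x ^+ 2) <= `|mu| * r1 * (U x ^+ 2 + V x ^+ 2).
    by rewrite -mulrA ler_wpM2l// ler_wpM2l ?lerDl// ltW.
  by lra.
have h1 : V x ^+ 2 / rho x <= 2 * energy_hi / r0.
  by apply: ler_pM => //; rewrite invr_ge0 ltW.
have h2 : rho x * `|U x| `^ (p + 1) <= r1 * ampl_hi by apply: ler_pM => //; exact: ltW.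
have h3 : `|mu| * (r1 * U x ^+ 2) <= `|mu| * (r1 * ampl_hi ^+ 2).
  by rewrite ler_wpM2l// ler_wpM2l// ltW.
have h4 := ler_wpM2l (ltW k0) (lerD h1 h2).
have eN : 2 * energy_hi * k / r0 + r1 * (k * ampl_hi + `|mu| * ampl_hi ^+ 2) =
  k * (2 * energy_hi / r0 + r1 * ampl_hi) + `|mu| * (r1 * ampl_hi ^+ 2) by ring.
have N0 : 0 <= k * (2 * energy_hi / r0 + r1 * ampl_hi) + `|mu| * (r1 * ampl_hi ^+ 2).
  apply: addr_ge0; last first.
    by apply: mulr_ge0 => //; apply: mulr_ge0; [exact: ltW|exact: sqr_ge0].
  apply: le_trans h4; rewrite mulr_ge0 ?(ltW k0)// addr_ge0//.
    by rewrite divr_ge0 ?(ltW rx0).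
  by rewrite mulr_ge0 ?(ltW rx0).
rewrite /slope_hi eN.
apply: (@le_trans _ _ ((k * (2 * energy_hi / r0 + r1 * ampl_hi) +
    `|mu| * (r1 * ampl_hi ^+ 2)) / (U x ^+ 2 + V x ^+ 2))).
  rewrite ler_wpM2r ?invr_ge0 ?(ltW S0)//.
  by move: t2; rewrite ler_norml => /andP[_ t2]; lra.
by rewrite ler_wpM2l// lef_pV2 ?posrE// exprn_gt0.
Qed.

Lemma angle_bounds : (k * slope_lo - `|mu| * r1) * X <= th X - th 0 <= slope_hi * X.
Proof.
have [[_ _ cth] _ deriv] := sol.
have lin (c x : R) : is_derive x 1 (fun y => c * y) (c * 1).
  by apply: is_derive_scalef; exact: is_derive_id.
have clin (c : R) : {within `[0, X], continuous (fun y => c * y)}.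
  by apply: continuous_subspaceT => x; exact: is_derive_continuous (lin c x).
apply/andP; split.
  have := @derive_ge0_le _ (fun x => th x - (k * slope_lo - `|mu| * r1) * x)
    (fun x => dth q k (rho x) (U x) (V x) - (k * slope_lo - `|mu| * r1) * 1) _ _ (ltW X0).
  rewrite mulr0 subr0 => H; suff : th 0 <= th X - (k * slope_lo - `|mu| * r1) * X by lra.
  apply: H => [x|x xX|x xX].
  - by apply: cvgB; [exact: cth|exact: clin].
  - by have [_ _ th'] := deriv x xX; exact: is_derive_subf.
  - by have /andP[h _] := angle_slope (ooW xX); rewrite subr_ge0 mulr1.
have := @derive_ge0_le _ (fun x => slope_hi * x - th x)
  (fun x => slope_hi * 1 - dth q k (rho x) (U x) (V x)) _ _ (ltW X0).
rewrite mulr0 => H; suff : 0 - th 0 <= slope_hi * X - th X by lra.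
apply: H => [x|x xX|x xX].
- by apply: cvgB; [exact: clin|exact: cth].
- by have [_ _ th'] := deriv x xX; exact: is_derive_subf.
- by have /andP[_ h] := angle_slope (ooW xX); rewrite subr_ge0 mulr1.
Qed.


End a_priori_bounds.
End shooting_problem.

(** * Shooting in the phase plane *)

Lemma compact_balls3 (R : realType) (M : R) : compact [set v : R * R * R | `|v| <= M].
Proof.
rewrite (_ : [set v | _] = `[(- M), M] `*` `[(- M), M] `*` `[(- M), M]).
  by apply: compact_setX; [apply: compact_setX|]; exact: segment_compact.
apply/seteqP; split => -[[a b] c] /=; rewrite !in_itv /= -!ler_norml !prod_normE /= !ge_max.
  by move=> /andP[/andP[-> ->] ->].
by move=> [[-> ->] ->].
Qed.

Section phase_shooting.
Context {R : realType}.
Implicit Types x : R.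
Variables (p mu X c1 c2 r0 r1 : R) (rho : R -> R).
Hypothesis hp : 0 < p < 1.
Hypothesis X0 : 0 < X.
Hypothesis crho : {within `[0, X], continuous rho}.
Hypotheses (r00 : 0 < r0) (rho_itv : forall x, 0 <= x <= X -> r0 <= rho x <= r1).

Notation f := (spow p).
Notation dV := (dV p mu).
Notation dth := (dth p mu).

Let rhoc x : R := rho (clamp X x).

Let rhoc_itv x : r0 <= rhoc x <= r1.
Proof. exact/rho_itv/clamp_itv. Qed.

Let rhoc_gt0 x : 0 < rhoc x.
Proof. by have /andP[/(lt_le_trans r00)] := rhoc_itv x. Qed.

Let r1_gt0 : 0 < r1.
Proof. by have /andP[h _] := rhoc_itv 0; apply: lt_le_trans (rhoc_gt0 0) _; case/andP: (rhoc_itv 0). Qed.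

Let rhoc_cont : continuous rhoc.
Proof. exact: continuous_comp_clamp. Qed.

Variable q : R.
Hypothesis q0 : 0 < q.

Let F (z : R * R * (R * R * R)) : R * R * R :=
  (dU (expR z.1.1) (rhoc z.1.2) z.2.1.2,
   dV (expR z.1.1) (rhoc z.1.2) z.2.1.1,
   dth q (expR z.1.1) (rhoc z.1.2) z.2.1.1 z.2.1.2).

Let y0 (t : R) : R * R * R := (1, - (c1 / expR t), atan (c1 / expR t)).

Let cF : continuous F.
Proof.
pose T := (R * R * (R * R * R))%type.
have ck : continuous (fun z : T => expR z.1.1).
  apply: continuous_compf; last exact: continuous_expR.
  by move=> z; apply: cvg_comp; exact: cvg_fst.
have cr : continuous (fun z : T => rhoc z.1.2).
  apply: continuous_compf; last exact: rhoc_cont.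
  by move=> z; apply: cvg_comp; [exact: cvg_fst|exact: cvg_snd].
have c2' : continuous (fun z : T => z.2) by move=> z; exact: cvg_snd.
have c21 : continuous (fun z : T => z.2.1).
  by move=> z; apply: (cvg_comp (fun z : T => z.2) fst (c2' z)); exact: cvg_fst.
have cU : continuous (fun z : T => z.2.1.1).
  by move=> z; apply: (cvg_comp (fun z : T => z.2.1) fst (c21 z)); exact: cvg_fst.
have cV : continuous (fun z : T => z.2.1.2).
  by move=> z; apply: (cvg_comp (fun z : T => z.2.1) snd (c21 z)); exact: cvg_snd.
have cki : continuous (fun z : T => (expR z.1.1)^-1).
  by apply: continuous_invf => // z; rewrite gt_eqF ?expR_gt0.
have cri : continuous (fun z : T => (rhoc z.1.2)^-1).
  by apply: continuous_invf => // z; rewrite gt_eqF.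
have cdU : continuous (fun z : T => dU (expR z.1.1) (rhoc z.1.2) z.2.1.2).
  by apply: continuous_mulf => //; exact: continuous_mulf.
have cdV : continuous (fun z : T => dV (expR z.1.1) (rhoc z.1.2) z.2.1.1).
  apply/continuous_oppf/continuous_mulf => //; apply: continuous_addf.
    apply: continuous_mulf => //; apply: continuous_compf => //.
    exact: continuous_spow.
  apply: continuous_mulf => //; apply: continuous_mulf => //.
  exact: cst_continuous.
have cdth : continuous (fun z : T =>
    dth q (expR z.1.1) (rhoc z.1.2) z.2.1.1 z.2.1.2).
  apply: continuous_mulf.
    apply: continuous_addf; first exact: continuous_mulf.
    by apply: continuous_oppf; exact: continuous_mulf.
  apply: continuous_invf => [z|]; first by rewrite gt_eqF// lt_max q0 orbT.
  apply: continuous_maxf.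
  by apply: continuous_addf; exact: continuous_mulf.
move=> z; apply: cvg_to_pair; last exact: cdth.
by apply: cvg_to_pair; [exact: cdU|exact: cdV].
Qed.

Let cy0 : continuous y0.
Proof.
have cc : continuous (fun t => c1 / expR t).
  apply: continuous_mulf; first exact: cst_continuous.
  apply: continuous_invf => [z|]; first by rewrite gt_eqF ?expR_gt0.
  exact: continuous_expR.
move=> t; apply: cvg_to_pair; last first.
  by apply: (continuous_compf cc) => ?; exact: continuous_atan.
by apply: cvg_to_pair; [exact: cvg_cst|apply: cvgN; exact: cc].
Qed.

Let growth_rate (k : R) : R := (k / r0 + r1 * (3 * k + `|mu|)) * (1 + q^-1).

Let growth (t1 t2 : R) : 0 <= t1 -> forall t x (v : R * R * R), t1 <= t <= t2 ->
  `|F (t, x, v)| <= growth_rate (expR t2) * (1 + `|v|).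
Proof.
move=> t10 t x [[U V] th] /andP[tt1 tt2].
have k1 : 1 <= expR t by rewrite -expR0 ler_expR; exact: le_trans tt1.
have kk : expR t <= expR t2 by rewrite ler_expR.
rewrite /F /=; set k := expR t in k1 kk *; set k2 := expR t2 in kk *.
set r := rhoc x; have /andP[lo hi] : r0 <= r <= r1 := rhoc_itv x.
have r_0 : 0 < r := rhoc_gt0 x.
have ir : r^-1 <= r0^-1 by rewrite lef_pV2 ?posrE.
have ir0 : 0 <= r^-1 by rewrite invr_ge0 ltW.
set N := `|(U, V, th)|.
have UN : `|U| <= N by rewrite /N !prod_normE /= !le_max lexx.
have VN : `|V| <= N by rewrite /N !prod_normE /= !le_max lexx !orbT.
have N0 : 0 <= N by exact: normr_ge0.
set A := k2 / r0 + r1 * (3 * k2 + `|mu|).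
have k20 : 0 < k2 by exact: expR_gt0.
have A1 : k2 / r0 <= A by rewrite /A lerDl mulr_ge0 ?(ltW r1_gt0)// addr_ge0// mulr_ge0// ltW.
have A2 : r1 * (3 * k2 + `|mu|) <= A by rewrite /A lerDr divr_ge0 ?ltW.
have A0 : 0 <= A by apply: le_trans A1; rewrite divr_ge0 ?ltW.
have iq : 0 < q^-1 by rewrite invr_gt0.
have CA : A <= growth_rate k2 by rewrite /growth_rate -/A ler_peMr// lerDl ltW.
have fU : `|f U| <= 1 + `|U| by rewrite norm_spow//; exact: powR_norm_le.
have muk : `|mu * U / k| <= `|mu| * `|U|.
  rewrite !normrM normfV (@ger0_norm _ k) ?ler_piMr ?mulr_ge0//; last lra.
  by rewrite invf_le1//; lra.
have bV : `|dV k r U| <= r1 * (k2 * (1 + `|U|) + `|mu| * `|U|).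
  rewrite /dV normrN normrM (gtr0_norm r_0); apply: ler_pM => //; first exact: ltW.
  apply: (le_trans (ler_normD _ _)); apply: lerD => //.
  by rewrite normrM (@ger0_norm _ k); [apply: ler_pM => //; lra|lra].
have bU : `|dU k r V| <= k2 / r0 * `|V|.
  rewrite /dU !normrM normfV (gtr0_norm r_0) (@ger0_norm _ k); last lra.
  by rewrite mulrAC ler_wpM2r//; apply: ler_pM => //; lra.
rewrite !prod_normE /= !ge_max; apply/andP; split; first (apply/andP; split).
- apply: (le_trans bU); apply: ler_pM => //; first by rewrite divr_ge0 ?ltW.
    exact: le_trans A1 _.
  by lra.
- apply: (le_trans bV); apply: (@le_trans _ _ (A * (1 + N))); last first.
    by rewrite ler_wpM2r//; lra.
  apply: (@le_trans _ _ (r1 * (3 * k2 + `|mu|) * (1 + N))); last first.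
    by rewrite ler_wpM2r//; lra.
  rewrite -mulrA ler_wpM2l ?(ltW r1_gt0)//.
  have := ler_wpM2l (normr_ge0 mu) UN; have := ler_wpM2l (ltW k20) UN.
  have := mulr_ge0 (ltW k20) N0; have := normr_ge0 mu; nra.
- have mx0 : 0 < Num.max (U ^+ 2 + V ^+ 2) q by rewrite lt_max q0 orbT.
  rewrite /dth normrM normfV (gtr0_norm mx0) ler_pdivrMr//.
  set mx := Num.max _ _ in mx0 *.
  have mx1 : 1 + (U ^+ 2 + V ^+ 2) <= (1 + q^-1) * mx.
    have : U ^+ 2 + V ^+ 2 <= mx by rewrite /mx le_max lexx.
    have : 1 <= q^-1 * mx by rewrite ler_pdivlMl// mulr1 /mx le_max lexx orbT.
    by rewrite mulrDl mul1r; lra.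
  have h1 : `|dU k r V * V| <= k2 / r0 * V ^+ 2.
    rewrite normrM -[V ^+ 2]real_normK ?num_real// expr2 mulrA.
    by rewrite ler_wpM2r.
  have h2 : `|U * dV k r U| <= r1 * (3 * k2 + `|mu|) * (1 + U ^+ 2).
    rewrite normrM; apply: (le_trans (ler_wpM2l (normr_ge0 U) bV)).
    rewrite mulrCA -mulrA ler_wpM2l ?(ltW r1_gt0)//.
    rewrite -[U ^+ 2]real_normK ?num_real//.
    move: (normr_ge0 U) (normr_ge0 mu); set u := `|U|; set m := `|mu| => u0 m0.
    have := sqr_ge0 (u - 1); rewrite !expr2; nra.
  have h3 : `|dU k r V * V - U * dV k r U| <= A * (1 + (U ^+ 2 + V ^+ 2)).
    apply: (le_trans (ler_normB _ _)); apply: (le_trans (lerD h1 h2)).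
    have := sqr_ge0 U; have := sqr_ge0 V => v0 u0.
    have := ler_wpM2r v0 A1; have := ler_wpM2r (_ : 0 <= 1 + U ^+ 2) A2.
    by move=> /(_ _); lra.
  apply: (le_trans h3).
  have -> : growth_rate k2 * (1 + N) * mx = A * ((1 + N) * ((1 + q^-1) * mx)).
    by rewrite /growth_rate -/A; ring.
  rewrite ler_wpM2l//; apply: (le_trans mx1).
  by rewrite ler_peMl; [|rewrite mulr_ge0 ?(ltW mx0)//; lra|lra].
Qed.

(** The parameter is t = ln k; the function g measures, up to n full turns, the
    gap between the final angle and the one prescribed by the boundary
    condition at X. *)
Lemma phase_shooting (t1 t2 : R) (n : nat) : 0 <= t1 -> t1 <= t2 ->
  exists t U V th, [/\ t1 <= t <= t2, phase_solution p mu X c1 rho q (expR t) U V th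
   & let g := th X - atan (c2 / expR t) - 2 * pi * n%:R in
     [\/ g = 0, t = t1 /\ 0 <= g | t = t2 /\ g <= 0] ].
Proof.
move=> t10 t12.
pose g (z : R * (R * R * R)) : R := z.2.2 - atan (c2 / expR z.1) - 2 * pi * n%:R.
have cg : continuous g.
  apply: continuous_addf; last exact: cst_continuous.
  apply: continuous_addf.
    by move=> z; apply: cvg_comp; exact: cvg_snd.
  apply: continuous_oppf; apply: continuous_compf => [|z]; last exact: continuous_atan.
  apply: continuous_mulf; first exact: cst_continuous.
  apply: continuous_invf => [z|]; first by rewrite gt_eqF ?expR_gt0.
  apply: continuous_compf => [z|]; first exact: cvg_fst.
  exact: continuous_expR.
have C0 : 0 <= growth_rate (expR t2).
  rewrite /growth_rate mulr_ge0//; last by rewrite addr_ge0// invr_ge0 ltW.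
  rewrite addr_ge0//; first by rewrite divr_ge0 ?expR_ge0// ltW.
  by rewrite mulr_ge0 ?(ltW r1_gt0)// addr_ge0// mulr_ge0// expR_ge0.
have norm_fst1 (v : R * R * R) : `|v.1.1| <= `|v|.
  by rewrite !prod_normE !le_max lexx.
have norm_snd1 (v : R * R * R) : `|v.1.2| <= `|v|.
  by rewrite !prod_normE !le_max lexx orbT.
have norm_snd2 (v : R * R * R) : `|v.2| <= `|v|.
  by rewrite !prod_normE !le_max lexx orbT.
have [t [y [t12' y00 Hy Hg]]] :=
  euler_shooting (@compact_balls3 R) cF cy0 cg t12 C0 (growth t10) (ltW X0).
exists t, (fun x => (y x).1.1), (fun x => (y x).1.2), (fun x => (y x).2); split => //.
have incr (pr : R * R * R -> R) : (forall v, `|pr v| <= `|v|) ->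
    (forall u v w (c : R), pr (u - v - c *: w) = pr u - pr v - c * pr w) ->
  forall x, 0 <= x -> forall e, 0 < e -> exists2 d, 0 < d & forall x', 0 <= x' ->
    `|x' - x| < d ->
    `|pr (y x') - pr (y x) - (x' - x) * pr (F (t, x, y x))| <= e * `|x' - x|.
  move=> pr1 prl x x0 e e0; have [d d0 Hd] := Hy x x0 e e0.
  by exists d => // x' x'0 /(Hd x' x'0); apply: le_trans; rewrite -prl.
have cont (g0 l : R -> R) : (forall x, 0 <= x -> forall e, 0 < e -> exists2 d, 0 < d & forall x', 0 <= x' ->
    `|x' - x| < d ->
    `|g0 x' - g0 x - (x' - x) * l x| <= e * `|x' - x|) ->
  {within `[0, X], continuous g0} /\ forall x, 0 < x < X -> is_derive x 1 g0 (l x).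
  move=> H; split.
    apply/subspace_continuousP => x; rewrite /= in_itv /= => /andP[x0 xX].
    have [d d0 Hd] := H x x0 1 ltr01.
    apply/cvgrPdist_le => e e0.
    rewrite near_withinE; apply/nbhs_ballP.
    exists (Num.min d (e / (1 + `|l x|))) => /=.
      by rewrite lt_min d0 divr_gt0// ltr_pwDl.
    move=> x' ; rewrite -ball_normE /= in_itv /= distrC lt_min => /andP[xd xe] /andP[x'0 _].
    have := Hd x' x'0 xd; rewrite mul1r => h.
    rewrite distrC -(subrK ((x' - x) * l x) (g0 x' - g0 x)).
    apply: (le_trans (ler_normD _ _)); rewrite normrM.
    apply: (le_trans (lerD h (lexx _))).
    by move: xe; rewrite ltr_pdivlMr ?ltr_pwDl// => /ltW; rewrite mulrDr mulr1.
  move=> x /andP[x0 xX]; apply: is_derive_epsP => e e0.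
  have [d d0 Hd] := H x (ltW x0) e e0.
  exists (Num.min d x); first by rewrite lt_min d0.
  move=> x'; rewrite lt_min => /andP[xd xx]; apply: Hd => //.
  by move: xx; rewrite ltr_norml => /andP[]; lra.
have [cU U'] := cont (fun x => (y x).1.1) _
  (incr (fun v => v.1.1) (fun v => norm_fst1 v) (fun _ _ _ _ => erefl)).
have [cV V'] := cont (fun x => (y x).1.2) _
  (incr (fun v => v.1.2) (fun v => norm_snd1 v) (fun _ _ _ _ => erefl)).
have [cth th'] := cont (fun x => (y x).2) _
  (incr (fun v => v.2) (fun v => norm_snd2 v) (fun _ _ _ _ => erefl)).
split => //; first by rewrite y00.
move=> x xX; have [/= x1 x2 x3] := And3 (U' x xX) (V' x xX) (th' x xX).
move: x1 x2 x3; rewrite /F /= /rhoc clamp_id//.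
by case/andP: xX => /ltW -> /ltW ->.
Qed.

End phase_shooting.

(** * Small solutions of the sublinear Sturm-Liouville problem *)

Section small_solutions.
Context {R : realType}.
Implicit Types x : R.
Variables (p mu X c1 c2 : R) (rho rho1 : R -> R).
Hypothesis hp : 0 < p < 1.
Hypothesis X0 : 0 < X.
Hypotheses (crho : {within `[0, X], continuous rho})
  (crho1 : {within `[0, X], continuous rho1})
  (drho : forall x, 0 < x < X -> is_derive x 1 rho (rho1 x))
  (rho_gt0 : forall x, 0 <= x <= X -> 0 < rho x).

Lemma coefficient_bounds : exists r0 r1 D : R, [/\ 0 < r0,
  forall x, 0 <= x <= X -> r0 <= rho x <= r1 &
  forall x, 0 <= x <= X -> `|rho1 x| <= D].
Proof.
have [x0 hx0 H0] := EVT_min (ltW X0) crho.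
have [x1 hx1 H1] := EVT_max (ltW X0) crho.
have cn : {within `[0, X], continuous (fun x => `|rho1 x|)}.
  by move=> x; apply: (cvg_comp rho1 Num.norm (@crho1 x)); exact: norm_continuous.
have [x2 hx2 H2] := EVT_max (ltW X0) cn.
exists (rho x0), (rho x1), `|rho1 x2|; split.
- by apply: rho_gt0; move: hx0; rewrite in_itv.
- by move=> x xX; rewrite H0 ?H1// in_itv.
- by move=> x xX; apply: H2; rewrite in_itv.
Qed.

(** At the frequency expR t1 the final angle is bounded, at the frequency
    expR t2 it exceeds any prescribed number of turns for t2 large; in between,
    some solution ends in the direction of the boundary condition. *)
Theorem small_solutions (e : R) : 0 < e ->
  exists u w : R -> R, [/\
    {within `[0, X], continuous u} /\ {within `[0, X], continuous w},
    (forall x, 0 < x < X -> is_derive x 1 u (w x / rho x)),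
    (forall x, 0 < x < X ->
       is_derive x 1 w (- (rho x * (mu * u x + spow p (u x))))),
    0 < u 0 /\ (forall x, 0 <= x <= X -> `|u x| <= e)
  & w 0 = - (c1 * u 0) /\ w X = - (c2 * u X) ].
Proof.
move=> e0; have [r0 [r1 [D [r00 rho_itv rho1_le]]]] := coefficient_bounds.
pose A := ampl_hi mu X c1 r0 r1 D.
pose m := ampl_lo mu X r0 r1 D.
pose H := slope_hi mu X c1 r0 r1 D.
pose c := slope_lo p mu X c1 r0 r1 D.
have m0 : 0 < m := ampl_lo_gt0 mu X r1 D r00.
have q0 : 0 < m ^+ 2 by rewrite exprn_gt0.
have p10 : p - 1 < 0 by case/andP: hp; lra.
have OX : 0 <= (0 : R) <= X by rewrite lexx ltW.
have r1_gt0 : 0 < r1.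
  by have /andP[h1 h2] := rho_itv 0 OX; apply: lt_le_trans r00 _; exact: le_trans h2.
have A0 : 0 < A.
  rewrite /A /ampl_hi ltr_pwDl// divr_ge0 ?sqr_ge0// mulr_ge0//.
  apply: mulr_ge0; last exact: expR_ge0.
  have := sqr_ge0 c1; have := sqr_ge0 r1; lra.
have c0 : 0 < c by rewrite lt_min invr_gt0 r1_gt0 mulr_gt0// powR_gt0.
(* beyond t1 the rescaled amplitude is at most e; the frequency expR t1 gives
   fewer than n turns, the frequency expR t2 gives more *)
pose t1 := Num.max 0 ((p - 1) / 2 * ln (e / A)).
have t10 : 0 <= t1 by rewrite /t1 le_max lexx.
pose n := (Num.truncn (H (expR t1) * X + pi)).+1.
have hn : H (expR t1) * X + pi < 2 * pi * n%:R.
  apply: (@lt_le_trans _ _ n%:R); first exact: truncnS_gt.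
  by rewrite ler_peMl//; have := pi_ge2 R; lra.
pose t2 := Num.max t1 ((2 * pi * n%:R + pi + `|mu| * r1 * X) / (c * X)).
have t12 : t1 <= t2 by rewrite /t2 le_max lexx.
have ht2 : 2 * pi * n%:R + pi < (expR t2 * c - `|mu| * r1) * X.
  have : 2 * pi * n%:R + pi + `|mu| * r1 * X < expR t2 * (c * X).
    rewrite -ltr_pdivrMr ?mulr_gt0//.
    apply: (@le_lt_trans _ _ t2); first by rewrite /t2 le_max lexx orbT.
    by have := expR_ge1Dx t2; lra.
  by lra.
have [t [U [V [th [/andP[tt1 _] sol /= Hg]]]]] :=
  phase_shooting mu c1 c2 hp X0 crho r00 rho_itv q0 n t10 t12.
have kge1 (s : R) : 0 <= s -> 1 <= expR s by rewrite -expR0 ler_expR.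
have tge0 : 0 <= t by exact: le_trans tt1.
have [[cU cV cth] [U0 V0 th0] deriv] := sol.
have := angle_bounds hp X0 crho drho r00 rho_itv rho1_le (kge1 t tge0) sol erefl.
rewrite -/c -/H => /andP[lo hi].
have a1 := atan_gtNpi2 (c1 / expR t); have a2 := atan_ltpi2 (c1 / expR t).
have b1 := atan_gtNpi2 (c2 / expR t); have b2 := atan_ltpi2 (c2 / expR t).
have pi0 := pi_gt0 R.
have {}Hg : th X = atan (c2 / expR t) + 2 * pi * n%:R.
  case: Hg => [|[tt g0]|[tt g0]]; first by lra.
    by exfalso; move: lo hi g0 a1 a2 b1 b2; rewrite th0 tt; lra.
  by exfalso; move: lo hi g0 a1 a2 b1 b2; rewrite th0 tt; lra.
have bnd x : 0 <= x <= X -> `|U x| <= A.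
  move=> xX.
  by have [] := solution_bounds hp X0 crho drho r00 rho_itv rho1_le (kge1 t tge0) sol xX.
have tr := angle_tracks hp X0 crho drho r00 rho_itv rho1_le (kge1 t tge0) sol erefl.
set k := expR t in sol U0 V0 th0 deriv tr Hg.
have k0 : 0 < k by exact: expR_gt0.
have VX : V X = - (c2 / k * U X).
  have ca0 : cos (atan (c2 / k)) != 0.
    by rewrite gt_eqF// cos_gt0_pihalf// atan_gtNpi2 atan_ltpi2.
  have per : 2 * pi * n%:R = (pi *+ 2) *+ n :> R.
    by rewrite -(mulr_natl pi) -[RHS]mulr_natr.
  move: tr; rewrite Hg per (periodicn (@sinD2pi R)) (periodicn (@cosD2pi R)).
  have sa : sin (atan (c2 / k)) = c2 / k * cos (atan (c2 / k)).
    by rewrite -{2}(atanK (c2 / k)) /tan divfK.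
  rewrite sa mulrCA mulrA -mulrDl => /eqP; rewrite mulf_eq0 (negbTE ca0) orbF.
  by rewrite addr_eq0 => /eqP ->; rewrite opprK.
pose s := expR (2 * t / (p - 1)).
have s0 : 0 < s by exact: expR_gt0.
have sk : s `^ (p - 1) = k ^+ 2.
  rewrite /powR gt_eqF// /s expRK mulrC divfK ?lt_eqF//.
  by rewrite mulrDl !mul1r expRD expr2.
have sA : s * A <= e.
  rewrite -ler_pdivlMr// /s -[leRHS]lnK ?posrE ?divr_gt0// ler_expR.
  rewrite ler_ndivrMr//.
  have : (p - 1) / 2 * ln (e / A) <= t by apply: le_trans tt1; rewrite /t1 le_max lexx orbT.
  by lra.
exists (fun x => s * U x), (fun x => s * k * V x); split.
- split=> x; apply: cvgM; try exact: cvg_cst; [exact: cU|exact: cV].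
- move=> x xX; have [U' _ _] := deriv x xX.
  have -> : s * k * V x / rho x = s * dU k (rho x) (V x) by rewrite /dU; ring.
  exact: is_derive_scalef.
- move=> x xX; have [_ V' _] := deriv x xX.
  have -> : - (rho x * (mu * (s * U x) + spow p (s * U x))) =
      s * k * dV p mu k (rho x) (U x).
    by rewrite spowM// sk /dV; field; rewrite gt_eqF.
  exact: is_derive_scalef.
- rewrite U0 mulr1; split => // x xX; apply: le_trans sA.
  by rewrite normrM gtr0_norm// ler_wpM2l ?(ltW s0)// bnd.
- rewrite U0 V0 VX; split; field; rewrite gt_eqF//.
Qed.

End small_solutions.

(** * Integrals of derivatives and a smooth step *)

Section interval_integrals.
Context {R : realType}.
Notation leb := (@lebesgue_measure R).

Lemma continuous_integrable_oo (f : R -> R) (a b : R) :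
  {within `[a, b], continuous f} -> leb.-integrable `]a, b[ (EFin \o f).
Proof.
move=> cf.
have H : leb.-integrable `[a, b] (EFin \o f).
  by apply: continuous_compact_integrable => //; exact: segment_compact.
by apply: integrableS H => //; exact: subset_itv_oo_cc.
Qed.

Lemma Rintegral_derive (f F : R -> R) (a b : R) : a < b ->
  {within `[a, b], continuous f} -> {within `[a, b], continuous F} ->
  (forall x, a < x < b -> is_derive x 1 F (f x)) ->
  \int[leb]_(x in `]a, b[) f x = F b - F a.
Proof.
move=> ab cf cF dF.
have H : leb.-integrable `[a, b] (EFin \o f).
  by apply: continuous_compact_integrable => //; exact: segment_compact.
rewrite Rintegral_itv_obnd_cbnd; last exact: continuous_integrable_oo.
rewrite Rintegral_itv_bndo_bndc; last first.
  by apply: integrableS H => //; exact: subset_itv_co_cc.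
rewrite /Rintegral (@continuous_FTC2 _ f F)//.
- have /continuous_within_itvP[] := cF => // _ Fa Fb; split => // x.
  by rewrite in_itv /= => /dF; case.
- by move=> x; rewrite in_itv /= => /dF[_]; rewrite derive1E.
Qed.

End interval_integrals.
(** Phrased with existential derivatives, n-fold differentiability is stable
    under products and inverses by a one-line induction. *)
Section iterated_differentiability.
Context {R : realType}.
Implicit Types (f g : R -> R).

Fixpoint differentiable_times (n : nat) f : Prop :=
  if n is n'.+1 then
    exists2 g, (forall x : R, is_derive x 1 f (g x)) & differentiable_times n' g
  else True.

Lemma differentiable_timesW n f :
  differentiable_times n.+1 f -> differentiable_times n f.
Proof.
elim: n f => [//|n IH] f [g fg Hg]; exists g => //; exact: IH.
Qed.

Lemma differentiable_timesD n f g : differentiable_times n f ->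
  differentiable_times n g -> differentiable_times n (fun x => f x + g x).
Proof.
elim: n f g => [//|n IH] f g [f' ff' Hf] [g' gg' Hg].
exists (fun x => f' x + g' x); last exact: IH.
by move=> x; exact: is_derive_addf.
Qed.

Lemma differentiable_timesM n f g : differentiable_times n f ->
  differentiable_times n g -> differentiable_times n (fun x => f x * g x).
Proof.
elim: n f g => [//|n IH] f g Hf Hg.
have Wf := differentiable_timesW Hf; have Wg := differentiable_timesW Hg.
case: Hf Hg => f' ff' Hf [g' gg' Hg].
exists (fun x => f' x * g x + f x * g' x).
  by move=> x; exact: is_derive_mulf.
by apply: differentiable_timesD; exact: IH.
Qed.

Lemma differentiable_times_cst n (c : R) : differentiable_times n (fun=> c).
Proof.
elim: n c => [//|n IH] c; exists (fun=> 0); last exact: IH.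
by move=> x; exact: is_derive_cst.
Qed.

Lemma differentiable_timesZ n (c : R) f : differentiable_times n f ->
  differentiable_times n (fun x => c * f x).
Proof. by move=> Hf; apply: differentiable_timesM => //; exact: differentiable_times_cst. Qed.

Lemma differentiable_timesV n f : (forall x, f x != 0) ->
  differentiable_times n f -> differentiable_times n (fun x => (f x)^-1).
Proof.
move=> f0; elim: n => [//|n IH] Hf.
have HV := IH (differentiable_timesW Hf).
case: Hf => f' ff' Hf.
exists (fun x => - 1 * (f' x * ((f x)^-1 * (f x)^-1))).
  move=> x; have := is_deriveV (f0 x) (ff' x).
  suff -> : - 1 * (f' x * ((f x)^-1 * (f x)^-1)) = - f x ^- 2 *: f' x by [].
  by rewrite /GRing.scale /=; field.
apply: differentiable_timesZ; apply: differentiable_timesM => //.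
exact: differentiable_timesM.
Qed.

Lemma differentiable_times_affine n f (k c : R) : differentiable_times n f ->
  differentiable_times n (fun x => f (k * x + c)).
Proof.
elim: n f => [//|n IH] f [f' ff' Hf].
exists (fun x => k * f' (k * x + c)); last by apply: differentiable_timesZ; exact: IH.
move=> x; rewrite [k * _]mulrC.
apply: (is_derive_compf (ff' _)).
have := is_derive_addf (is_derive_scalef k (is_derive_id x 1)) (is_derive_cst c x 1).
by rewrite mulr1 addr0.
Qed.

Lemma differentiable_times_derive1n n f : differentiable_times n.+1 f ->
  forall x, derivable (derive1n n f) x 1.
Proof.
elim: n f => [|n IH] f [f' ff' Hf] x; first by have [] := ff' x.
rewrite /derive1n iterSr; rewrite (_ : derive1 f = f'); first exact: IH.
by apply/funext => y; rewrite derive1E; have [] := ff' y.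
Qed.

End iterated_differentiability.

Section smooth_step.
Context {R : realType}.
Implicit Types x : R.

(** The functions x^-k e^(-1/x), extended by 0 to the half-line x <= 0: their
    span is stable under derivation, which makes them all smooth. *)
Definition flat (k : nat) x : R := if 0 < x then x ^- k * expR (- x^-1) else 0.

Lemma flat_le0 k x : x <= 0 -> flat k x = 0.
Proof. by rewrite /flat ltNge => ->. Qed.

Lemma flat_ge0 k x : 0 <= flat k x.
Proof.
rewrite /flat; case: ifP => // x0.
by rewrite mulr_ge0 ?expR_ge0// invr_ge0 exprn_ge0// ltW.
Qed.

Lemma flat_gt0 x : 0 < x -> 0 < flat 0 x.
Proof. by move=> x0; rewrite /flat x0 expr0 invr1 mul1r expR_gt0. Qed.

(** From e^y >= y^(k+2) / (k+2)! with y = 1/x; the quadratic rate is what makes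
    the functions flat differentiable at 0. *)
Lemma flat_small k x : 0 < x -> flat k x <= k.+2`!%:R * x ^+ 2.
Proof.
move=> x0; rewrite /flat x0 expRN.
have ix : 0 < x^-1 by rewrite invr_gt0.
have := @expR_ge1Dxn R x^-1 k.+1 (ltW ix); set F := (k.+2`!%:R : R).
have F0 : 0 < F by rewrite ltr0n fact_gt0.
move=> h; have {h} : x^-1 ^+ k.+2 / F <= expR x^-1 by lra.
rewrite ler_pdivrMr// => h.
rewrite ler_pdivrMr ?expR_gt0// -exprVn.
have -> : x^-1 ^+ k = x ^+ 2 * x^-1 ^+ k.+2.
  by rewrite -(addn2 k) exprD mulrCA -exprMn divff ?gt_eqF// expr1n mulr1.
rewrite [F * _]mulrC -[leRHS]mulrA; apply: ler_wpM2l; first exact: sqr_ge0.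
by rewrite [leRHS]mulrC.
Qed.

Lemma is_derive_flat k x :
  is_derive x 1 (flat k) (- k%:R * flat k.+1 x + flat k.+2 x).
Proof.
have [x0|x0|->] := ltgtP x 0.
- rewrite !flat_le0 ?ltW// mulr0 addr0.
  apply: (@near_eq_is_derive _ _ _ (fun=> 0)).
  by near=> y; rewrite flat_le0//; apply/ltW; near: y; exact: lt_nbhsl.
- have near_flat : \forall y \near x, y^-1 ^+ k * expR (- y^-1) = flat k y.
    by near=> y; rewrite /flat ifT ?exprVn//; near: y; exact: lt_nbhsr.
  have x_neq0 : x != 0 by rewrite gt_eqF.
  have dV : is_derive x 1 (fun y : R => y^-1) (- x ^- 2).
    have := is_deriveV x_neq0 (is_derive_id x 1).
    by rewrite /GRing.scale /= mulr1.
  have dE : is_derive x 1 (fun y : R => expR (- y^-1)) (expR (- x^-1) * (- - x ^- 2)).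
    exact: (is_derive_compf (is_derive_expR _) (is_derive_oppf dV)).
  have dX : is_derive x 1 (fun y : R => y^-1 ^+ k) (k%:R * x^-1 ^+ k.-1 * - x ^- 2).
    by have := is_deriveX k dV; rewrite exprfctE.
  suff -> : - k%:R * flat k.+1 x + flat k.+2 x =
    (k%:R * x^-1 ^+ k.-1 * - x ^- 2) * expR (- x^-1) +
      x^-1 ^+ k * (expR (- x^-1) * (- - x ^- 2)).
    by apply: (near_eq_is_derive near_flat); exact: is_derive_mulf.
  rewrite /flat x0 -!exprVn; case: k {dX near_flat} => [|k] /=; rewrite !exprS; ring.
- rewrite !flat_le0// mulr0 addr0; apply: is_derive_epsP => e e0.
  set F := (k.+2`!%:R : R); have F0 : 0 < F by rewrite ltr0n fact_gt0.
  exists (e / F); first by rewrite divr_gt0.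
  move=> y; rewrite subr0 (@flat_le0 k 0)// subr0 mulr0 subr0 => ye.
  rewrite ger0_norm ?flat_ge0//; have [y0|y0] := leP y 0.
    by rewrite flat_le0// mulr_ge0// ltW.
  apply: (le_trans (flat_small k y0)); rewrite (gtr0_norm y0) expr2 mulrA.
  rewrite ler_wpM2r ?(ltW y0)// mulrC -ler_pdivlMr//.
  by move: ye; rewrite gtr0_norm// => /ltW.
Unshelve. all: by end_near. Qed.

Lemma differentiable_times_flat n k : differentiable_times n (flat k).
Proof.
elim: n k => [//|n IH] k.
exists (fun x => - k%:R * flat k.+1 x + flat k.+2 x).
  exact: is_derive_flat.
by apply: differentiable_timesD => //; exact: differentiable_timesZ.
Qed.

Let den x : R := flat 0 x + flat 0 (1 - x).

Let den_gt0 x : 0 < den x.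
Proof.
have [x0|x0] := leP x 0.
  by rewrite /den ltr_wpDl ?flat_ge0// flat_gt0; lra.
by rewrite /den ltr_pwDl ?flat_ge0// flat_gt0.
Qed.

Definition smooth_step x : R := flat 0 x / den x.

Definition dsmooth_step x : R :=
  (flat 2 x * flat 0 (1 - x) + flat 0 x * flat 2 (1 - x)) / den x ^+ 2.

Lemma smooth_step_le0 x : x <= 0 -> smooth_step x = 0.
Proof. by move=> x0; rewrite /smooth_step flat_le0// mul0r. Qed.

Lemma smooth_step_ge1 x : 1 <= x -> smooth_step x = 1.
Proof.
move=> x1; rewrite /smooth_step /den (@flat_le0 0 (1 - x)); last lra.
by rewrite addr0 divff// gt_eqF// flat_gt0; lra.
Qed.

Lemma differentiable_times_smooth_step n : differentiable_times n smooth_step.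
Proof.
have H0 := differentiable_times_flat n 0.
apply: differentiable_timesM => //.
apply: differentiable_timesV => [x|]; first by rewrite gt_eqF ?den_gt0.
apply: differentiable_timesD => //.
rewrite (_ : (fun x => flat 0 (1 - x)) = (fun x => flat 0 (- 1 * x + 1))).
  exact: differentiable_times_affine.
by apply/funext => x; rewrite mulN1r addrC.
Qed.

Lemma dsmooth_step_ge0 x : 0 <= dsmooth_step x.
Proof.
by rewrite /dsmooth_step divr_ge0 ?sqr_ge0// addr_ge0// mulr_ge0 ?flat_ge0.
Qed.

Lemma dsmooth_step_out x : x <= 0 \/ 1 <= x -> dsmooth_step x = 0.
Proof.
case=> h; rewrite /dsmooth_step.
  by rewrite !(@flat_le0 _ x)// !mul0r addr0 mul0r.
by rewrite !(@flat_le0 _ (1 - x)) ?mulr0 ?addr0 ?mul0r//; lra.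
Qed.

Lemma is_derive_smooth_step x : is_derive x 1 smooth_step (dsmooth_step x).
Proof.
have d1 (y : R) : is_derive y 1 (flat 0) (flat 2 y).
  by have := is_derive_flat 0 y; rewrite oppr0 mul0r add0r.
have d2 : is_derive x 1 (fun y => flat 0 (1 - y)) (flat 2 (1 - x) * (0 - 1)).
  by apply: (is_derive_compf (d1 _)); exact: is_derive_subf.
have den0 : den x != 0 by rewrite gt_eqF ?den_gt0.
have dd : is_derive x 1 den (flat 2 x + flat 2 (1 - x) * (0 - 1)).
  exact: is_derive_addf.
have := is_derive_mulf (d1 x) (is_deriveV den0 dd).
suff -> : dsmooth_step x = flat 2 x * (den x)^-1 +
   flat 0 x * (- den x ^- 2 *: (flat 2 x + flat 2 (1 - x) * (0 - 1))) by [].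
rewrite /dsmooth_step /GRing.scale /= /den.
by move: den0; rewrite /den => den0; field.
Qed.

Lemma continuous_dsmooth_step : continuous dsmooth_step.
Proof.
have cf k : continuous (flat k).
  by move=> x; exact: is_derive_continuous (is_derive_flat k x).
have cf1 k : continuous (fun x => flat k (1 - x)).
  apply: continuous_compf (cf k) => x.
  by apply: cvgB; [exact: cvg_cst|exact: cvg_id].
have cd : continuous den by exact: continuous_addf.
apply: continuous_mulf.
  by apply: continuous_addf; exact: continuous_mulf.
apply: continuous_invf => [x|]; last by apply: continuous_mulf.
by rewrite gt_eqF// exprn_gt0// den_gt0.
Qed.

End smooth_step.

(** * Continuous weak derivatives *)

Section du_bois_reymond.
Context {R : realType}.
Notation leb := (@lebesgue_measure R).
Implicit Types (w f phi : R -> R) (x y : R).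

Lemma continuous_near_lt w (x m : R) : {for x, continuous w} -> w x < m ->
  exists2 d : R, 0 < d & forall y : R, `|y - x| < d -> w y < m.
Proof.
move=> cw wm; have /cvgrPdist_lt/(_ (m - w x)) := cw.
rewrite subr_gt0 => /(_ wm) /nbhs_ballP[d /= d0 Hd]; exists d => // y yd.
have := Hd y; rewrite -ball_normE /= distrC => /(_ yd).
by rewrite ltr_norml => /andP[]; lra.
Qed.

Lemma test_function_cont phi : test_function phi ->
  [/\ continuous phi, continuous (derive1 phi),
      forall x : R, is_derive x 1 phi (derive1 phi x) & phi 0 = 0 /\ phi pi = 0].
Proof.
move=> [dphi [c [d [c0 dpi supp]]]].
have d0 x : derivable phi x 1 := dphi 0%N x.
have d1 x : derivable (derive1 phi) x 1 := dphi 1%N x.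
split.
- by move=> x; exact/differentiable_continuous/derivable1_diffP.
- by move=> x; exact/differentiable_continuous/derivable1_diffP.
- by move=> x; split => //; rewrite derive1E.
- split; apply/eqP; apply/negPn/negP => /supp/andP[]; lra.
Qed.

(** If w took different values at x1 and x2, a test function rising from 0 to 1
    next to x1 and falling back next to x2 would have a derivative that
    separates them. *)
Lemma weak_derivative0_cst w : {within Iclosed R, continuous w} ->
  (forall phi, test_function phi ->
     \int[leb]_(x in Iopen R) (w x * derive1 phi x) = 0) ->
  forall x1 x2, 0 < x1 < pi -> 0 < x2 < pi -> w x1 = w x2.
Proof.
move=> cw w0.
have cwo x : 0 < x < pi -> {for x, continuous w}.
  move=> xpi; have /continuous_within_itvP[//|+ _ _] := cw; first exact: pi_gt0.
  by apply; rewrite in_itv.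
suff H x1 x2 : 0 < x1 < pi -> 0 < x2 < pi -> ~ (w x1 < w x2).
  move=> x1 x2 h1 h2; apply/eqP; rewrite eq_le !leNgt.
  by apply/andP; split; apply/negP; exact: H.
move=> h1 h2 w12.
pose m := (w x1 + w x2) / 2; pose eta := (w x2 - w x1) / 4.
have eta0 : 0 < eta by rewrite /eta; lra.
have [d1 d10 Hd1] : exists2 d : R, 0 < d & forall y, `|y - x1| < d -> w y < m - eta.
  by apply: continuous_near_lt; [exact: cwo|rewrite /m /eta; lra].
have [d2 d20 Hd2] : exists2 d : R, 0 < d & forall y, `|y - x2| < d -> - w y < - (m + eta).
  apply: (@continuous_near_lt (fun y => - w y)); last by rewrite /m /eta; lra.
  by apply: cvgN; exact: cwo.
pose e := Num.min (Num.min d1 d2) (Num.min ((pi - x1) / 2) ((pi - x2) / 2)).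
case/andP: (h1) => x10 x1pi; case/andP: (h2) => x20 x2pi.
have e0 : 0 < e by rewrite !lt_min d10 d20 !divr_gt0// subr_gt0.
have ed1 : e <= d1 by rewrite /e !ge_min lexx.
have ed2 : e <= d2 by rewrite /e !ge_min lexx !orbT.
have ep1 : e <= (pi - x1) / 2 by rewrite /e !ge_min lexx !orbT.
have ep2 : e <= (pi - x2) / 2 by rewrite /e !ge_min lexx !orbT.
pose st (a y : R) : R := smooth_step (e^-1 * y + - (e^-1 * a)).
pose b (a y : R) : R := dsmooth_step (e^-1 * y + - (e^-1 * a)) * (e^-1 * 1 + 0).
have stE (a y : R) : e^-1 * y + - (e^-1 * a) = (y - a) / e by field; rewrite gt_eqF.
have st_le (a y : R) : y <= a -> st a y = 0.
  move=> ya; rewrite /st stE smooth_step_le0// pmulr_lle0 ?invr_gt0//; lra.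
have st_ge (a y : R) : a + e <= y -> st a y = 1.
  move=> ya; rewrite /st stE smooth_step_ge1// ler_pdivlMr//; lra.
have dst (a y : R) : is_derive y 1 (st a) (b a y).
  exact: (is_derive_compf (is_derive_smooth_step _)).
have b_ge0 (a y : R) : 0 <= b a y.
  by rewrite /b mulr_ge0 ?dsmooth_step_ge0// mulr1 addr0 invr_ge0 ltW.
have b_out (a y : R) : y <= a \/ a + e <= y -> b a y = 0.
  move=> h; rewrite /b stE dsmooth_step_out ?mul0r//; case: h => h; [left|right].
    by rewrite pmulr_lle0 ?invr_gt0//; lra.
  by rewrite ler_pdivlMr//; lra.
have cb (a : R) : continuous (b a).
  apply: continuous_mulf; last exact: cst_continuous.
  apply: (continuous_compf _ continuous_dsmooth_step).
  apply: continuous_addf; last exact: cst_continuous.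
  apply: continuous_mulf; first exact: cst_continuous.
  by move=> y; exact: cvg_id.
have cst' (a : R) : continuous (st a) by move=> y; exact: is_derive_continuous (dst a y).
pose phi y := st x1 y - st x2 y.
have dphi y : is_derive y 1 phi (b x1 y - b x2 y) by exact: is_derive_subf.
have dphiE : derive1 phi = (fun y => b x1 y - b x2 y).
  by apply/funext => y; rewrite derive1E; have [] := dphi y.
have tphi : test_function phi.
  split.
    move=> n x; apply: differentiable_times_derive1n.
    have H (a : R) : differentiable_times n.+1 (st a).
      exact/differentiable_times_affine/differentiable_times_smooth_step.
    rewrite (_ : phi = (fun y => st x1 y + (-1) * st x2 y)).
      by apply: differentiable_timesD => //; exact: differentiable_timesZ.
    by apply/funext => y; rewrite /phi mulN1r.
  exists (Num.min x1 x2), (Num.max (x1 + e) (x2 + e)); split.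
  - by rewrite lt_min x10.
  - by rewrite gt_max; apply/andP; split; lra.
  - move=> y; apply: contraNT; rewrite negb_and -!ltNge lt_min gt_max => /orP[]/andP[y1 y2].
      by rewrite /phi !st_le ?subrr ?ltW.
    by rewrite /phi !st_ge ?subrr ?ltW.
have pi0 := pi_gt0 R.
have cs (g : R -> R) : continuous g -> {within `[0, pi], continuous g}.
  by move=> cg; exact: continuous_subspaceT.
have cdphi : continuous (fun y => b x1 y - b x2 y).
  by apply: continuous_addf => //; exact: continuous_oppf.
have i1 : leb.-integrable `]0, pi[ (EFin \o (fun x => w x * (b x1 x - b x2 x))).
  apply: continuous_integrable_oo => x; apply: cvgM; first exact: cw.
  exact: (cs _ cdphi).
have i2 : leb.-integrable `]0, pi[ (EFin \o (fun x => m * (b x1 x - b x2 x))).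
  apply/continuous_integrable_oo/cs; apply: continuous_mulf => //.
  exact: cst_continuous.
have i3 : leb.-integrable `]0, pi[ (EFin \o (fun x => - eta * (b x1 x + b x2 x))).
  apply/continuous_integrable_oo/cs; apply: continuous_mulf.
    exact: cst_continuous.
  exact: continuous_addf.
have I1 : \int[leb]_(x in `]0, pi[) (w x * (b x1 x - b x2 x)) = 0.
  by have := w0 phi tphi; rewrite dphiE.
have st0 : st x1 0 = 0 /\ st x2 0 = 0 by split; apply: st_le; exact: ltW.
have stpi : st x1 pi = 1 /\ st x2 pi = 1 by split; apply: st_ge; lra.
case: st0 stpi => s10 s20 [s1pi s2pi].
have I2 : \int[leb]_(x in `]0, pi[) (m * (b x1 x - b x2 x)) = 0.
  rewrite (@Rintegral_derive _ _ (fun y => m * phi y))//.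
  - by rewrite /phi s10 s20 s1pi s2pi; ring.
  - apply/cs; apply: continuous_mulf => //; exact: cst_continuous.
  - apply/cs; apply: continuous_mulf; first exact: cst_continuous.
    by apply: continuous_addf => //; exact: continuous_oppf.
have I3 : \int[leb]_(x in `]0, pi[) (- eta * (b x1 x + b x2 x)) = - eta * 2.
  rewrite (@Rintegral_derive _ _ (fun y => - eta * (st x1 y + st x2 y)))//.
  - by rewrite s10 s20 s1pi s2pi; ring.
  - apply/cs; apply: continuous_mulf; [exact: cst_continuous|exact: continuous_addf].
  - apply/cs; apply: continuous_mulf; [exact: cst_continuous|exact: continuous_addf].
have : \int[leb]_(x in `]0, pi[) (w x * (b x1 x - b x2 x) - m * (b x1 x - b x2 x)) <=
    \int[leb]_(x in `]0, pi[) (- eta * (b x1 x + b x2 x)).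
  apply: le_Rintegral => //.
    have := @integrableB _ _ _ leb _ _ _ _ i1 i2; exact.
  move=> y _.
  have B1 : (w y - m) * b x1 y <= - eta * b x1 y.
    have [yx|xy] := leP y x1; first by rewrite (b_out x1)// ?mulr0//; left.
    have [ye|ye] := leP (x1 + e) y; first by rewrite (b_out x1)// ?mulr0//; right.
    rewrite ler_wpM2r//; have := Hd1 y; rewrite ger0_norm; last lra.
    by move=> h; have := h (lt_le_trans (_ : y - x1 < e) ed1); lra.
  have B2 : - (w y - m) * b x2 y <= - eta * b x2 y.
    have [yx|xy] := leP y x2; first by rewrite (b_out x2)// ?mulr0//; left.
    have [ye|ye] := leP (x2 + e) y; first by rewrite (b_out x2)// ?mulr0//; right.
    rewrite ler_wpM2r//; have := Hd2 y; rewrite ger0_norm; last lra.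
    by move=> h; have := h (lt_le_trans (_ : y - x2 < e) ed2); lra.
  by lra.
by rewrite RintegralB// I1 I2 I3; lra.
Qed.

(** The difference between f and a primitive of f1 has zero weak derivative. *)
Lemma weak_derivative_is_derive f f1 :
  {within Iclosed R, continuous f} -> {within Iclosed R, continuous f1} ->
  weak_derivative f f1 -> forall x, 0 < x < pi -> is_derive x 1 f (f1 x).
Proof.
move=> cf cf1 wf.
have pi0 := pi_gt0 R.
have mI : measurable (Iopen R) by exact: measurable_itv.
pose g x := f1 (clamp pi x).
have cg : continuous g by exact: continuous_comp_clamp.
have gE x : 0 < x < pi -> g x = f1 x.
  by case/andP => ? ?; rewrite /g clamp_id// !ltW.
pose W x := \int[leb]_(t in `[-1, x]) g t.
have dW x : -1 < x -> is_derive x 1 W (g x).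
  move=> x1; have xu : x < x + 1 by rewrite ltrDl.
  have ig : leb.-integrable `[-1, x + 1] (EFin \o g).
    by apply: continuous_compact_integrable;
      [exact: segment_compact|exact: continuous_subspaceT].
  have [h1 h2] := @continuous_FTC1_closed R g (-1) x (x + 1) xu ig x1 (cg x).
  by split => //; rewrite -derive1E.
have cW : {within Iclosed R, continuous W}.
  apply: derivable_within_continuous => x; rewrite in_itv /= => /andP[x0 _].
  by have [] := dW x _; first lra.
have cs (h : R -> R) : continuous h -> {within `[0, pi], continuous h}.
  by move=> ch; exact: continuous_subspaceT.
have const : forall x1 x2, 0 < x1 < pi -> 0 < x2 < pi -> f x1 - W x1 = f x2 - W x2.
  apply: (@weak_derivative0_cst (fun x => f x - W x)).
    by move=> x; apply: cvgB; [exact: cf|exact: cW].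
  move=> phi tphi; have [cphi cdphi dphi [phi0 phipi]] := test_function_cont tphi.
  have i1 : leb.-integrable `]0, pi[ (EFin \o (fun x => f x * derive1 phi x)).
    by apply: continuous_integrable_oo => x; apply: cvgM; [exact: cf|exact: (cs _ cdphi)].
  have i2 : leb.-integrable `]0, pi[ (EFin \o (fun x => W x * derive1 phi x)).
    by apply: continuous_integrable_oo => x; apply: cvgM; [exact: cW|exact: (cs _ cdphi)].
  have i3 : leb.-integrable `]0, pi[ (EFin \o (fun x => g x * phi x)).
    by apply/continuous_integrable_oo/cs; exact: continuous_mulf.
  have IW : \int[leb]_(x in Iopen R) (g x * phi x + W x * derive1 phi x) = 0.
    have dWp x : 0 < x < pi -> is_derive x 1 (fun x => W x * phi x)
        (g x * phi x + W x * derive1 phi x).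
      by move=> /andP[x0 _]; apply: is_derive_mulf => //; apply: dW; lra.
    rewrite (Rintegral_derive pi0 _ _ dWp).
    - by rewrite phi0 phipi !mulr0 subrr.
    - move=> x; apply: cvgD; first by apply: cvgM; [exact: (cs _ cg)|exact: (cs _ cphi)].
      by apply: cvgM; [exact: cW|exact: (cs _ cdphi)].
    - by move=> x; apply: cvgM; [exact: cW|exact: (cs _ cphi)].
  rewrite RintegralD// in IW.
  transitivity (\int[leb]_(x in Iopen R) (f x * derive1 phi x - W x * derive1 phi x)).
    by apply: eq_Rintegral => x _; rewrite mulrBl.
  have wfp : \int[leb]_(x in Iopen R) (f x * derive1 phi x) =
    - \int[leb]_(x in Iopen R) (f1 x * phi x) := wf phi tphi.
  rewrite RintegralB// wfp.
  have -> : \int[leb]_(x in Iopen R) (f1 x * phi x) = \int[leb]_(x in Iopen R) (g x * phi x).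
    by apply: eq_Rintegral => x; rewrite inE /Iopen /= in_itv /= => /gE ->.
  by move: IW; lra.
move=> x xpi; rewrite -gE//.
have dWK : is_derive x 1 (fun y => W y + (f x - W x)) (g x + 0).
  by apply: is_derive_addf; first by apply: dW; case/andP: xpi; lra.
rewrite addr0 in dWK; apply: near_eq_is_derive dWK.
near=> y; rewrite (const x y)//; first by rewrite addrC subrK.
by near: y; have := @near_in_itvoo R 0 pi x; rewrite in_itv => /(_ xpi).
Unshelve. all: by end_near. Qed.

End du_bois_reymond.

(** * Integration over a rectangle *)

Section rectangle_integrals.
Context {R : realType}.
Notation leb := (@lebesgue_measure R).

(** On the grid of mesh 1/(n+1) in the first variable, a continuous function is
    replaced by countably many continuous functions of the second variable. *)
Lemma continuous_measurable_fun2 (G : R * R -> R) : continuous G ->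
  measurable_fun [set: R * R] G.
Proof.
move=> cG.
pose s (n : nat) (t : R) : R := (Num.floor (t * n.+1%:R))%:~R / n.+1%:R.
apply: (@measurable_fun_cvg _ _ _ setT (fun n z => G (s n z.1, z.2)) G).
  move=> n _ Y mY; rewrite setTI.
  rewrite (_ : _ @^-1` Y = \bigcup_(k in [set: int])
     ([set t : R | k%:~R / n.+1%:R <= t < (k + 1)%:~R / n.+1%:R] `*`
      ((fun x : R => G (k%:~R / n.+1%:R, x)) @^-1` Y))).
    apply: countable_bigcupT_measurable => // k; apply: measurableX.
      rewrite (_ : mkset _ = `[k%:~R / n.+1%:R, (k + 1)%:~R / n.+1%:R[%classic)//.
    have cGk : continuous (fun x : R => G (k%:~R / n.+1%:R, x)).
      move=> x; apply: (@cvg_comp_pair _ _ _ _ (nbhs x) _ G (cst _) id).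
      - exact: cG.
      - exact: cvg_cst.
      - exact: cvg_id.
    by have := continuous_measurable_fun cGk measurableT mY; rewrite setTI.
  apply/seteqP; split => -[t x] /=.
    move=> HY; exists (Num.floor (t * n.+1%:R)) => //; split => //=.
    by rewrite ler_pdivrMr// ltr_pdivlMr// floor_le floorD1_gt.
  move=> [k _ [/=]]; rewrite ler_pdivrMr// ltr_pdivlMr// => kt.
  by rewrite /s (floor_def kt).
move=> [t x] _ /=.
apply: (@cvg_comp_pair _ _ _ _ _ _ G (fun n => s n t) (fun=> x)); [exact: cG| |exact: cvg_cst].
apply/cvgrPdist_lt => e e0; near=> n.
have ne : n.+1%:R^-1 < e by near: n; exact: (near_infty_natSinv_lt (PosNum e0)).
have : (Num.floor (t * n.+1%:R))%:~R <= t * n.+1%:R < (Num.floor (t * n.+1%:R) + 1)%:~R.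
  by rewrite floor_le floorD1_gt.
rewrite intrD -ler_pdivrMr// -ltr_pdivlMr// mulrDl -/(s n t) mul1r => /andP[h1 h2].
by rewrite ger0_norm ?subr_ge0// ltrBlDl; apply: (lt_trans h2); rewrite ltrD2l.
Unshelve. all: by end_near. Qed.

Variables (A B : R).
Hypotheses (A0 : 0 < A) (B0 : 0 < B).
Variable F : R * R -> R.
Hypothesis cF : {within `[0, A] `*` `[0, B], continuous F}.

Let G (z : R * R) : R := F (clamp A z.1, clamp B z.2).

Let GE z : (`[0, A] `*` `[0, B])%classic z -> G z = F z.
Proof.
by case: z => t x [/=]; rewrite !in_itv /= => ? ?; rewrite /G /= !clamp_id.
Qed.

Let cG : continuous G.
Proof.
move: cF => /subspace_continuousP c z.
have inr (y : R * R) : (`[0, A] `*` `[0, B])%classic (clamp A y.1, clamp B y.2).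
  by split; rewrite /= in_itv /= clamp_itv.
apply: (cvg_comp (fun y : R * R => (clamp A y.1, clamp B y.2)) F _ (c _ (inr z))).
move=> P; rewrite /= nbhs_simpl /within /= => HP.
have cc : (fun y : R * R => (clamp A y.1, clamp B y.2)) @ z -->
    (clamp A z.1, clamp B z.2).
  apply: cvg_to_pair.
    by apply: (cvg_comp fst (clamp A) cvg_fst); exact: continuous_clamp.
  by apply: (cvg_comp snd (clamp B) cvg_snd); exact: continuous_clamp.
have := cc _ HP; rewrite nbhs_simpl /=.
by apply: filterS => y /=; apply; exact: inr.
Qed.

Let oo_cc z : (`]0, A[ `*` `]0, B[)%classic z -> (`[0, A] `*` `[0, B])%classic z.
Proof. by case=> h1 h2; split; exact: subset_itv_oo_cc. Qed.

Let mrect : measurable (`]0, A[ `*` `]0, B[ : set (R * R)).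
Proof. by apply: measurableX; exact: measurable_itv. Qed.

Lemma rectangle_measurable : measurable_fun (`]0, A[ `*` `]0, B[) F.
Proof.
apply: (@eq_measurable_fun _ _ _ _ _ G).
  by move=> z; rewrite inE => /oo_cc /GE.
by apply: measurable_funTS; apply: continuous_measurable_fun2; exact: cG.
Qed.

Lemma rectangle_measure : leb2 R (`]0, A[ `*` `]0, B[) = (A * B)%:E.
Proof.
rewrite /leb2 product_measure1E// EFinM.
have len (a : R) : 0 < a -> leb `]0, a[%classic = a%:E.
  by move=> a0; rewrite lebesgue_measure_itv /= lte_fin a0 oppr0 adde0.
by congr (_ * _)%E; exact: len.
Qed.

Lemma rectangle_bounded : exists M : R, forall z,
  (`[0, A] `*` `[0, B])%classic z -> `|F z| <= M.
Proof.
have cpt : compact (`[0, A] `*` `[0, B] : set (R * R)).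
  by apply: compact_setX; exact: segment_compact.
have /compact_bounded[M [_ HM]] : compact (F @` (`[0, A] `*` `[0, B])).
  exact: continuous_compact.
exists (M + 1) => z hz; apply: HM; first by rewrite ltrDl.
by exists z.
Qed.

Lemma rectangle_integrable :
  (leb2 R).-integrable (`]0, A[ `*` `]0, B[) (EFin \o F).
Proof.
apply: measurable_bounded_integrable => //.
- by apply: (@le_lt_trans _ _ (A * B)%:E); [rewrite -rectangle_measure|exact: ltry].
- exact: rectangle_measurable.
- have [M HM] := rectangle_bounded; exists M; split; first exact: num_real.
  move=> M' MM' z hz; apply: (le_trans (HM z (oo_cc hz))); exact: ltW.
Qed.

Lemma rectangle_section_t (x : R) : 0 <= x <= B ->
  {within `[0, A], continuous (fun t => F (t, x))}.
Proof.
move=> xB.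
have cGx : continuous (fun t : R => G (t, x)).
  by move=> t; apply: (@cvg_comp_pair _ _ _ _ (nbhs t) _ G id (cst x));
    [exact: cG|exact: cvg_id|exact: cvg_cst].
apply: (@subspace_eq_continuous _ _ _ (fun t => G (t, x))); last exact: continuous_subspaceT.
move=> t; rewrite inE => ht; by rewrite /from_subspace GE//; split => //=; rewrite in_itv.
Qed.

Lemma rectangle_section_x (t : R) : 0 <= t <= A ->
  {within `[0, B], continuous (fun x => F (t, x))}.
Proof.
move=> tA.
have cGt : continuous (fun x : R => G (t, x)).
  by move=> x; apply: (@cvg_comp_pair _ _ _ _ (nbhs x) _ G (cst t) id);
    [exact: cG|exact: cvg_cst|exact: cvg_id].
apply: (@subspace_eq_continuous _ _ _ (fun x => G (t, x))); last exact: continuous_subspaceT.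
move=> x; rewrite inE => hx; by rewrite /from_subspace GE//; split => //=; rewrite in_itv.
Qed.

Let ooW (a x : R) : 0 < x < a -> 0 <= x <= a.
Proof. by case/andP => /ltW -> /ltW ->. Qed.

Let restr : (leb2 R).-integrable setT ((EFin \o F) \_ (`]0, A[ `*` `]0, B[)).
Proof.
have iff := @integrable_mkcond _ _ R (leb2 R) (`]0, A[ `*` `]0, B[)%classic (EFin \o F).
apply: (iff _).1; last exact: rectangle_integrable.
by apply: measurableX; exact: measurable_itv.
Qed.

Let Rint0 (a : R) (f : R -> R) : {within `[0, a], continuous f} ->
  \int[leb]_(x in `]0, a[) f x = 0 ->
  integral leb `]0, a[ (fun x => (f x)%:E) = 0%E.
Proof.
move=> cf; rewrite /Rintegral => f0.
have fin : integral leb `]0, a[ (fun x => (f x)%:E) \is a fin_num.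
  by apply: integrable_fin_num => //; exact: continuous_integrable_oo.
by rewrite -(fineK fin) f0.
Qed.

(** Fubini, in the only form needed: iterated integrals that vanish section by
    section. *)
Lemma rectangle_integral0_t :
  (forall x, 0 < x < B -> \int[leb]_(t in `]0, A[) F (t, x) = 0) ->
  \int[leb2 R]_(z in `]0, A[ `*` `]0, B[) F z = 0.
Proof.
move=> H; rewrite /Rintegral integral_mkcond /leb2 -integral21_prod_meas1; last exact: restr.
rewrite integral0_eq// => x _; rewrite /fubini_G.
have [xB|xB] := boolP (0 < x < B).
  rewrite -[RHS](Rint0 (rectangle_section_t (ooW xB)) (H x xB)) [RHS]integral_mkcond.
  apply: eq_integral => t _; rewrite /patch; congr (if _ then _ else _).
  apply/idP/idP; rewrite !inE; first by case.
  by move=> h; split => //=; rewrite in_itv.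
rewrite integral0_eq// => t _; rewrite /patch ifF//; apply/negP; rewrite inE => -[_] /=.
by rewrite in_itv /=; apply/negP.
Qed.

Lemma rectangle_integral0_x :
  (forall t, 0 < t < A -> \int[leb]_(x in `]0, B[) F (t, x) = 0) ->
  \int[leb2 R]_(z in `]0, A[ `*` `]0, B[) F z = 0.
Proof.
move=> H; rewrite /Rintegral integral_mkcond /leb2 -integral12_prod_meas1; last exact: restr.
rewrite integral0_eq// => t _; rewrite /fubini_F.
have [tA|tA] := boolP (0 < t < A).
  rewrite -[RHS](Rint0 (rectangle_section_x (ooW tA)) (H t tA)) [RHS]integral_mkcond.
  apply: eq_integral => x _; rewrite /patch; congr (if _ then _ else _).
  apply/idP/idP; rewrite !inE; first by case.
  by move=> h; split => //=; rewrite in_itv.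
rewrite integral0_eq// => x _; rewrite /patch ifF//; apply/negP; rewrite inE => -[] /=.
by rewrite in_itv /= => + _; apply/negP.
Qed.

End rectangle_integrals.

(** * Stationary solutions of the wave equation *)

Lemma derive1_local (R : realType) (f g : R -> R) (a b t l : R) : a < t < b ->
  (forall s, a < s < b -> f s = g s) -> is_derive t 1 g l -> derive1 f t = l.
Proof.
move=> tab fg dg.
have nfg : \forall s \near t, g s = f s.
  near=> s; rewrite fg//; near: s; have := @near_in_itvoo R a b t.
  by rewrite in_itv => /(_ tab).
by rewrite derive1E; have [] := near_eq_is_derive nfg dg.
Unshelve. all: by end_near. Qed.

Section stationary_solutions.
Context {R : realType}.
Notation leb := (@lebesgue_measure R).
Variables (a1 b1 a2 b2 T mu p : R) (rho rho1 u w : R -> R).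
Hypotheses (T0 : 0 < T) (hp : 0 < p < 1) (b10 : b1 != 0) (b20 : b2 != 0).
Hypotheses (crho : {within `[0, pi], continuous rho})
  (crho1 : {within `[0, pi], continuous rho1})
  (drho : forall x : R, 0 < x < pi -> is_derive x 1 rho (rho1 x))
  (rho_gt0 : forall x : R, 0 <= x <= pi -> 0 < rho x).
Hypotheses (cu : {within `[0, pi], continuous u})
  (cw : {within `[0, pi], continuous w})
  (du : forall x : R, 0 < x < pi -> is_derive x 1 u (w x / rho x))
  (dw : forall x : R, 0 < x < pi ->
     is_derive x 1 w (- (rho x * (mu * u x + spow p (u x))))).
Hypotheses (w0 : w 0 = - (a1 * rho 0 / b1 * u 0))
  (wpi : w pi = - (a2 * rho pi / b2 * u pi)).

Let pi0 : 0 < pi :> R := pi_gt0 R.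

Lemma within_snd (g : R -> R) : {within `[0, pi], continuous g} ->
  {within Omega_bar T, continuous (fun z => g z.2)}.
Proof.
move=> cg; have cgc := continuous_comp_clamp pi0 cg.
have c2 : continuous (fun z : R * R => g (clamp pi z.2)).
  by move=> z; apply: (cvg_comp snd (fun x => g (clamp pi x)) cvg_snd); exact: cgc.
apply: (@subspace_eq_continuous _ _ _ (fun z : R * R => g (clamp pi z.2))).
  move=> -[t x]; rewrite inE /from_subspace => -[_ /=]; rewrite /Iclosed /= in_itv /= => xpi.
  by rewrite clamp_id.
exact: continuous_subspaceT.
Qed.

Let f x : R := spow p (u x).

Let cf : {within `[0, pi], continuous f}.
Proof. by move=> x; apply: (cvg_comp u (spow p) (@cu x)); exact: continuous_spow. Qed.

Section against_test_function.
Variables (psi : R * R -> R) (d : nat -> nat -> R * R -> R).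
Hypothesis smooth : smooth_upto_boundary T psi d.
Hypotheses (bc0 : forall t, 0 <= t <= T -> a1 * psi (t, 0) + b1 * d 0%N 1%N (t, 0) = 0)
  (bcpi : forall t, 0 <= t <= T -> a2 * psi (t, pi) + b2 * d 0%N 1%N (t, pi) = 0)
  (per : forall x, 0 <= x <= pi -> d 1%N 0%N (0, x) = d 1%N 0%N (T, x)).

Let inO t x : 0 < t < T -> 0 < x < pi -> Omega T (t, x).
Proof. by move=> tT xpi; split; rewrite /Iopen /Iclosed /= in_itv. Qed.

Let inOb t x : 0 <= t <= T -> 0 <= x <= pi -> Omega_bar T (t, x).
Proof. by move=> tT xpi; split; rewrite /Iopen /Iclosed /= in_itv. Qed.

Let ooW (a x : R) : 0 < x < a -> 0 <= x <= a.
Proof. by case/andP => /ltW -> /ltW ->. Qed.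

(** The derivatives in wave_op are taken of psi itself, which agrees with d 0 0 on
    the closed rectangle; interior points see only that. *)
Lemma wave_opE t x : 0 < t < T -> 0 < x < pi ->
  wave_op rho psi (t, x) = rho x * d 2%N 0%N (t, x) -
    (rho1 x * d 0%N 1%N (t, x) + rho x * d 0%N 2%N (t, x)).
Proof.
move=> tT xpi; have [psiE cd dt dx] := smooth; rewrite /wave_op /=.
have psit s : 0 < s < T -> derive1 (fun s => psi (s, x)) s = d 1%N 0%N (s, x).
  move=> sT; apply: (derive1_local sT) (dt 0%N 0%N s x (inO sT xpi)) => s' s'T.
  by apply/psiE/inOb; exact: ooW.
have psix y : 0 < y < pi -> derive1 (fun y => psi (t, y)) y = d 0%N 1%N (t, y).
  move=> ypi; apply: (derive1_local ypi) (dx 0%N 0%N t y (inO tT ypi)) => s' s'T.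
  by apply/psiE/inOb; exact: ooW.
congr (_ * _ - _).
  exact: (derive1_local tT psit) (dt 1%N 0%N t x (inO tT xpi)).
apply: (@derive1_local _ _ (fun y => rho y * d 0%N 1%N (t, y)) 0 pi _ _ xpi).
  by move=> y ypi; rewrite psix.
apply: is_derive_mulf; first exact: drho.
exact: dx (inO tT xpi).
Qed.

(** The integrand is the t-derivative of u rho psi_t minus the x-derivative of
    u rho psi_x - w psi. The first integrates to 0 by periodicity, the second
    because u and psi satisfy the same boundary conditions. *)
Lemma stationary_identity :
  \int[leb2 R]_(z in Omega T) (u z.2 * wave_op rho psi z) -
  \int[leb2 R]_(z in Omega T)
    ((mu * u z.2 + `|u z.2| `^ (p - 1) * u z.2) * psi z * rho z.2) = 0.
Proof.
have [psiE cd dt dx] := smooth.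
have cu2 := within_snd cu; have cr2 := within_snd crho.
have cr12 := within_snd crho1; have cf2 := within_snd cf.
pose A z := u z.2 * (rho z.2 * d 2%N 0%N z).
pose B z := u z.2 * (rho1 z.2 * d 0%N 1%N z + rho z.2 * d 0%N 2%N z).
pose C z := (mu * u z.2 + f z.2) * d 0%N 0%N z * rho z.2.
have cA : {within Omega_bar T, continuous A}.
  move=> z; apply: cvgM; first exact: cu2.
  by apply: cvgM; [exact: cr2|exact: cd].
have cB : {within Omega_bar T, continuous B}.
  move=> z; apply: cvgM; first exact: cu2.
  by apply: cvgD; apply: cvgM; [exact: cr12|exact: cd|exact: cr2|exact: cd].
have cC : {within Omega_bar T, continuous C}.
  move=> z; apply: cvgM; last exact: cr2.
  apply: cvgM; last exact: cd.
  by apply: cvgD; [apply: cvgM; [exact: cvg_cst|exact: cu2]|exact: cf2].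
have cAB : {within Omega_bar T, continuous (fun z => A z - B z)}.
  by move=> z; apply: cvgB; [exact: cA|exact: cB].
have cBC : {within Omega_bar T, continuous (fun z => B z + C z)}.
  by move=> z; apply: cvgD; [exact: cB|exact: cC].
have E1 : \int[leb2 R]_(z in Omega T) (u z.2 * wave_op rho psi z) =
    \int[leb2 R]_(z in Omega T) (A z - B z).
  apply: eq_Rintegral => -[t x]; rewrite inE => -[/=].
  rewrite /Iopen /= !in_itv /= => tT xpi; rewrite wave_opE// /A /B /=; ring.
have E2 : \int[leb2 R]_(z in Omega T)
    ((mu * u z.2 + `|u z.2| `^ (p - 1) * u z.2) * psi z * rho z.2) =
    \int[leb2 R]_(z in Omega T) C z.
  apply: eq_Rintegral => -[t x]; rewrite inE => -[/=].
  rewrite /Iopen /= !in_itv /= => tT xpi; rewrite psiE//.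
  by apply: inOb; exact: ooW.
have IA : \int[leb2 R]_(z in Omega T) A z = 0.
  apply: (rectangle_integral0_t T0 pi0 cA) => x xpi.
  have xpi' := ooW xpi.
  have sec i j := rectangle_section_t T0 pi0 (cd i j) xpi'.
  rewrite /A /=.
  have dA t : 0 < t < T -> is_derive t 1 (fun t => u x * (rho x * d 1%N 0%N (t, x)))
      (u x * (rho x * d 2%N 0%N (t, x))).
    by move=> tT; do 2 apply: is_derive_scalef; exact: dt (inO tT xpi).
  rewrite (Rintegral_derive T0 _ _ dA).
  - by rewrite per// subrr.
  - by move=> t; do 2 (apply: cvgM; first exact: cvg_cst); exact: sec.
  - by move=> t; do 2 (apply: cvgM; first exact: cvg_cst); exact: sec.
have IBC : \int[leb2 R]_(z in Omega T) (B z + C z) = 0.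
  apply: (rectangle_integral0_x T0 pi0 cBC) => t tT.
  have tT' := ooW tT.
  have sec i j := rectangle_section_x T0 pi0 (cd i j) tT'.
  have dG x : 0 < x < pi -> is_derive x 1
      (fun x => u x * (rho x * d 0%N 1%N (t, x)) - w x * d 0%N 0%N (t, x))
      (B (t, x) + C (t, x)).
    move=> xpi; have rx0 : rho x != 0 by rewrite gt_eqF// rho_gt0// ooW.
    have -> : B (t, x) + C (t, x) =
      (w x / rho x * (rho x * d 0%N 1%N (t, x)) +
       u x * (rho1 x * d 0%N 1%N (t, x) + rho x * d 0%N 2%N (t, x))) -
      (- (rho x * (mu * u x + spow p (u x))) * d 0%N 0%N (t, x) +
       w x * d 0%N 1%N (t, x)).
      by rewrite /B /C /f /=; field.
    apply: is_derive_subf; apply: is_derive_mulf; try exact: du; try exact: dw.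
      apply: is_derive_mulf; first exact: drho.
      exact: dx (inO tT xpi).
    exact: dx (inO tT xpi).
  rewrite (Rintegral_derive pi0 _ _ dG).
  - have b0 := bc0 tT'; have bp := bcpi tT'.
    rewrite psiE in b0; last by apply: inOb; rewrite // lexx ltW.
    rewrite psiE in bp; last by apply: inOb; rewrite // lexx ltW.
    have e0 : d 0%N 1%N (t, 0) = - (a1 / b1 * d 0%N 0%N (t, 0)).
      apply: (mulfI b10); rewrite mulrN mulrA [b1 * (a1 / b1)]mulrC divfK//; lra.
    have ep : d 0%N 1%N (t, pi) = - (a2 / b2 * d 0%N 0%N (t, pi)).
      apply: (mulfI b20); rewrite mulrN mulrA [b2 * (a2 / b2)]mulrC divfK//; lra.
    by rewrite w0 wpi e0 ep; field; apply/andP; split.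
  - exact: (rectangle_section_x T0 pi0 cBC tT').
  - move=> x; apply: cvgB.
      by apply: cvgM; [exact: cu|apply: cvgM; [exact: crho|exact: sec]].
    by apply: cvgM; [exact: cw|exact: sec].
have mO : measurable (Omega T) by apply: measurableX; exact: measurable_itv.
have iA := rectangle_integrable T0 pi0 cA.
have iB := rectangle_integrable T0 pi0 cB.
have iC := rectangle_integrable T0 pi0 cC.
have iAB := rectangle_integrable T0 pi0 cAB.
have iBC := rectangle_integrable T0 pi0 cBC.
rewrite E1 E2 RintegralB//; move: IBC; rewrite RintegralD// IA; lra.
Qed.

End against_test_function.
End stationary_solutions.

(** * Small weak solutions *)

Section stationary_weak_solutions.
Context {R : realType}.
Variables (a1 b1 a2 b2 T mu p : R) (rho rho1 : R -> R) (beta0 : R).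
Hypotheses (T0 : 0 < T) (hp : 0 < p < 1) (b10 : b1 != 0) (b20 : b2 != 0).
Hypotheses (crho : {within `[0, pi], continuous rho})
  (crho1 : {within `[0, pi], continuous rho1})
  (drho : forall x : R, 0 < x < pi -> is_derive x 1 rho (rho1 x))
  (rho_itv : forall x : R, 0 <= x <= pi -> 0 < rho x <= beta0).

Let pi0 : 0 < pi :> R := pi_gt0 R.

Let rho_gt0 (x : R) : 0 <= x <= pi -> 0 < rho x.
Proof. by move=> /rho_itv/andP[]. Qed.

Let mO : measurable (Omega T). Proof. by apply: measurableX; exact: measurable_itv. Qed.

Lemma powint_stationary (u : R -> R) (e : R) :
  {within `[0, pi], continuous u} -> (forall x, 0 <= x <= pi -> `|u x| <= e) ->
  (0 <= powint rho T (p + 1) (fun z => u z.2) <= (e `^ (p + 1) * beta0 * (T * pi))%:E)%E.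
Proof.
move=> cu ue.
have OinP z : Omega T z -> 0 <= z.2 <= pi.
  by case: z => t x [_ /=]; rewrite /Iopen /= in_itv /= => /andP[/ltW -> /ltW ->].
have h0 z : Omega T z -> 0 <= `|u z.2| `^ (p + 1) * rho z.2.
  by move=> /OinP zpi; rewrite mulr_ge0 ?powR_ge0// ltW// rho_gt0.
rewrite /powint; apply/andP; split.
  by apply: integral_ge0 => z Oz; rewrite lee_fin h0.
have e0 : 0 <= e by apply: le_trans (ue 0 _); rewrite ?normr_ge0// lexx ltW.
have p0 : 0 <= p + 1 by case/andP: hp; lra.
have cF : {within Omega_bar T, continuous (fun z => `|u z.2| `^ (p + 1) * rho z.2)}.
  apply: (@within_snd R T (fun x => `|u x| `^ (p + 1) * rho x)) => x.
  apply: cvgM; last exact: crho.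
  by apply: (cvg_comp u (fun v => `|v| `^ (p + 1)) (cu x)); exact: continuous_powR_norm.
apply: (@le_trans _ _ (\int[leb2 R]_(z in Omega T) (cst (e `^ (p + 1) * beta0)%:E z))%E).
  apply: ge0_le_integral => //.
  - by apply/measurable_EFinP; exact: (rectangle_measurable T0 pi0 cF).
  - move=> z Oz; rewrite lee_fin /cst; have zpi := OinP z Oz.
    have /andP[r0 rb] := rho_itv zpi.
    apply: ler_pM; rewrite ?powR_ge0 ?(ltW r0)//.
    by apply: ge0_ler_powR; rewrite ?nnegrE// ue.
by rewrite integral_cst// [leRHS]EFinM -(rectangle_measure T0 pi0).
Qed.

Lemma small_weak_solution (e : R) : 0 < e -> exists u : R -> R,
  [/\ weak_solution rho a1 b1 a2 b2 T mu p (p + 1) (fun z => u z.2),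
      {within `[0, pi], continuous u}, 0 < u 0
    & forall x, 0 <= x <= pi -> `|u x| <= e].
Proof.
move=> e0.
have [u [w [[cu cw] du dw [u0 ue] [w0 wpi]]]] :=
  small_solutions mu (a1 * rho 0 / b1) (a2 * rho pi / b2) hp pi0 crho crho1 drho rho_gt0 e0.
exists u; split => //; split.
  split.
    by have := rectangle_measurable T0 pi0 (within_snd (T := T) cu).
  by have /andP[_ h] := powint_stationary cu ue; exact: le_lt_trans h (ltry _).
move=> psi [d [smooth bc0 bcpi _ per]].
exact: (stationary_identity T0 hp b10 b20 crho crho1 drho rho_gt0 cu cw du dw w0 wpi smooth bc0 bcpi per).
Qed.

End stationary_weak_solutions.

(** By continuity u exceeds u 0 / 2, hence v, on a strip next to x = 0, which has
    positive measure. *)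
Lemma not_ae_eq_stationary (R : realType) (T : R) (u v : R -> R) : 0 < T ->
  {within `[0, pi], continuous u} ->
  (forall x, 0 <= x <= pi -> `|v x| <= u 0 / 2) -> 0 < u 0 ->
  ~ (\forall z \ae leb2 R, Omega T z -> u z.2 = v z.2).
Proof.
move=> T0 cu vu u0; have pi0 := pi_gt0 R.
have cuc := continuous_comp_clamp pi0 cu.
have c0 : clamp pi 0 = 0 :> R by rewrite clamp_id// lexx ltW.
have [d d0 Hd] : exists2 d : R, 0 < d &
    forall y : R, `|y - 0| < d -> - u (clamp pi y) < - (u 0 / 2).
  apply: (@continuous_near_lt _ (fun y => - u (clamp pi y))).
    by apply: cvgN; exact: cuc.
  by rewrite c0; lra.
pose e := Num.min d pi.
have e0 : 0 < e by rewrite lt_min d0.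
have ed : e <= d by rewrite /e ge_min lexx.
have epi : e <= pi by rewrite /e ge_min lexx orbT.
have sub z : (`]0, T[ `*` `]0, e[)%classic z -> Omega T z /\ u z.2 <> v z.2.
  case: z => t x [/=]; rewrite !in_itv /= => tT /andP[x0 xe].
  have xpi : 0 <= x <= pi by rewrite !ltW// (lt_le_trans xe).
  split.
    by split; rewrite /Iopen /= in_itv //= x0 (lt_le_trans xe).
  have := Hd x; rewrite subr0 gtr0_norm// clamp_id// => /(_ (lt_le_trans xe ed)).
  by have := vu x xpi; rewrite ler_norml => /andP[_ h1] h2 h3; move: h2; rewrite h3; lra.
move=> [N [mN N0 HN]].
pose Q : set (R * R) := `]0, T[ `*` `]0, e[.
have : (leb2 R Q <= leb2 R N)%E.
  apply: le_measure; rewrite ?inE//.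
    by apply: measurableX; exact: measurable_itv.
  by move=> z /sub[Oz uv]; apply: HN => /= /(_ Oz).
by rewrite (rectangle_measure T0 e0) N0 lee_fin leNgt mulr_gt0.
Qed.

(** * The theorem *)

Unset Implicit Arguments.

Theorem theorem2p3 (R : realType) (a b : nat) (ha : (0 < a)%N) (hb : (0 < b)%N)
  (hab : coprime a b)
  (a1 b1 a2 b2 : R) (h1 : a1 ^+ 2 + b1 ^+ 2 != 0) (h2 : a2 ^+ 2 + b2 ^+ 2 != 0)
  (rho rho1 rho2 : R -> R) (hrho : in_H2 rho rho1 rho2)
  (beta0 : R) (hbeta0 : forall x, 0 <= x <= pi -> 0 < rho x <= beta0)
  (heta : (0 < ess_inf_0pi (eta_rho rho rho1 rho2))%E)
  (p : R) (hp : 0 < p < 1)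
  (alpha1_eq0 : a1 - b1 / 2 * (rho1 0 / rho 0) = 0)
  (beta1_gt0 : 0 < - b1)
  (alpha2_eq0 : a2 - b2 / 2 * (rho1 pi / rho pi) = 0)
  (beta2_gt0 : 0 < b2)
  (mu : R) (hmu : ~ Lambda rho a1 b1 a2 b2 (period R a b) mu)
  (hmu1 : 2 / pi * \int[lebesgue_measure]_(x in Iopen R)
                     eta_rho rho rho1 rho2 x < mu) :
  exists u : nat -> R * R -> R,
  [/\ forall l, weak_solution rho a1 b1 a2 b2 (period R a b) mu p (p + 1) (u l),
      forall l m, l <> m ->
        ~ (\forall z \ae leb2 R, Omega (period R a b) z -> u l z = u m z)
    & powint rho (period R a b) (p + 1) (u l) @[l --> \oo] --> (0%:E : \bar R)].
Proof.
have T0 : 0 < period R a b.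
  by rewrite /period divr_gt0 ?ltr0n// !mulr_gt0 ?pi_gt0 ?ltr0n.
have b10 : b1 != 0 by rewrite lt_eqF// -oppr_gt0.
have b20 : b2 != 0 by rewrite gt_eqF.
case: hrho => _ crho crho1 wrho _.
have drho := weak_derivative_is_derive crho crho1 wrho.
set T := period R a b in T0 *.
have ex (e : R) : exists u : R -> R, 0 < e ->
   [/\ weak_solution rho a1 b1 a2 b2 T mu p (p + 1) (fun z => u z.2),
      {within `[0, pi], continuous u}, 0 < u 0
    & forall x, 0 <= x <= pi -> `|u x| <= e].
  have [e0|e0] := ltP 0 e; last by exists (fun=> 0).
  have [u Hu] := small_weak_solution a1 a2 mu T0 hp b10 b20 crho crho1 drho hbeta0 e0.
  by exists u.
have [sol Hsol] := choice ex.
(* the amplitude of each solution is at most half the value at 0 of all the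
   previous ones, which keeps the solutions pairwise distinct *)
pose amp := fix amp (n : nat) : R :=
  if n is n'.+1 then Num.min (amp n') (sol (amp n') 0) / 2 else 1.
have amp_gt0 n : 0 < amp n.
  elim: n => [|n IH] /=; first exact: ltr01.
  by have [_ _ s0 _] := Hsol _ IH; rewrite divr_gt0// lt_min IH.
have amp_half n : amp n.+1 <= amp n / 2 by rewrite /= ler_wpM2r ?invr_ge0// ge_min lexx.
have amp_sol n : amp n.+1 <= sol (amp n) 0 / 2.
  by rewrite /= ler_wpM2r ?invr_ge0// ge_min lexx orbT.
have amp_le n : amp n <= 2^-1 ^+ n.
  elim: n => [|n IH]; first by rewrite expr0.
  by apply: (le_trans (amp_half n)); rewrite exprS mulrC ler_wpM2l// invr_ge0.
have amp_mono l m : (l <= m)%N -> amp m <= amp l.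
  elim: m => [|m IH]; first by rewrite leqn0 => /eqP ->.
  rewrite leq_eqVlt => /predU1P[->//|]; rewrite ltnS => /IH.
  by apply: le_trans; have := amp_half m; have := amp_gt0 m; lra.
exists (fun l z => sol (amp l) z.2); split.
- by move=> l; have [] := Hsol _ (amp_gt0 l).
- have lt_distinct l m : (l < m)%N ->
      ~ (\forall z \ae leb2 R, Omega T z -> sol (amp l) z.2 = sol (amp m) z.2).
    move=> lm; have [_ cl l0 _] := Hsol _ (amp_gt0 l).
    have [_ _ _ bm] := Hsol _ (amp_gt0 m).
    apply: not_ae_eq_stationary => // x xpi; apply: (le_trans (bm x xpi)).
    exact: le_trans (amp_mono _ _ lm) (amp_sol l).
  move=> l m /eqP; rewrite neq_ltn => /orP[/lt_distinct//|/lt_distinct H].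
  move=> [N [mN N0 HN]]; apply: H; exists N; split => // z hz; apply: HN => h.
  by apply: hz => Oz; rewrite h.
- pose K := beta0 * (T * pi).
  have hp1 : 1 <= p + 1 by case/andP: hp; lra.
  apply: (@squeeze_cvge _ _ _ _ (cst 0%E) _ (fun l => (2^-1 ^+ l * K)%:E)).
  + near=> l; have [_ cl _ bl] := Hsol _ (amp_gt0 l).
    have /andP[-> h] := powint_stationary T0 hp crho hbeta0 cl bl.
    apply: (le_trans h); rewrite lee_fin -mulrA -/K ler_wpM2r//.
      have /andP[r0 rb] : 0 < rho 0 <= beta0.
        by apply: hbeta0; rewrite lexx ltW ?pi_gt0.
      by rewrite /K mulr_ge0 ?mulr_ge0 ?(ltW T0) ?pi_ge0// (le_trans (ltW r0)).
    apply: le_trans (amp_le l); apply: ge1r_powR => //.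
    rewrite amp_gt0 (le_trans (amp_le l))// exprn_ile1 ?invr_ge0// invf_le1//.
    by lra.
  + exact: cvg_cst.
  + apply: cvg_EFin; first by near=> l.
    rewrite -(mul0r K); apply: cvgM; last exact: cvg_cst.
    by apply: cvg_expr; rewrite ger0_norm ?invr_ge0// invf_lt1//; lra.
Unshelve. all: by end_near. Qed.
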